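(* Let $g:[-1,1]\to\mathbb{R}$ be continuously differentiable and let $\psi:\mathcal{M}_+\to\mathbb{R}$ satisfy: (H2) $|\psi(\mu)-\psi(\nu)|\le \|\psi\|_{\mathrm{Lip},\mathrm{TV}}\,\mathrm{TV}(\mu,\nu)$ for all $\mu,\nu\in\mathcal{M}_+$; (H3') there exists $a>0$ such that for every integer $K\ge1$, $\nabla\psi^{(K)}\in L^\infty(\mathbb{R}_{\ge0}^{D_K};\mathcal{K}_{=a,K}')$; (H4) there is a constant $\|\psi\|_{\mathrm{Lip},W}<\infty$ with $|\psi(\mathbb{P})-\psi(\mathbb{Q})|\le\|\psi\|_{\mathrm{Lip},W}W(\mathbb{P},\mathbb{Q})$ for all probability measures $\mathbb{P},\mathbb{Q}$ on $[-1,1]$. Let $a$ be as in (H3'). For $b\in\mathbb{R}$ such that $\widetilde g_b(z)=g(z)+b$ is positive on $[-1,1]$, let $\widetilde\psi_b(\mu)=\psi(\mu)+ab\,\mu[-1,1]$ for $\mu\in\mathcal{M}_+$, let $\widetilde f_b:[0,\infty)\times\mathcal{M}_+\to\mathbb{R}$ be the solution to the infinite-dimensional Hamilton-Jacobi equation with kernel $\widetilde g_b$ and initial condition $\widetilde\psi_b$ (defined in the context as a limit of finite-dimensional viscosity solutions), and set $$f_b(t,\mu)=\widetilde f_b(t,\mu)-ab\,\mu[-1,1]-\frac{a^2bt}{2}.$$ Then $f_b$ does not depend on the choice of $b$: for all $b,b'\in\mathbb{R}$ such that $\widetilde g_b$ and $\widetilde g_{b'}$ are positive on $[-1,1]$,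 $f_b(t,\mu)=f_{b'}(t,\mu)$ for every $t\ge0$ and $\mu\in\mathcal{M}_+$. (The common function is defined to be the solution to the infinite-dimensional Hamilton-Jacobi equation with kernel $g$ and initial condition $\psi$.)
   Context: $\mathcal{M}_+$ is the set of finite non-negative measures on $[-1,1]$, $\mathrm{TV}(\mu,\nu)=\sup_A|\mu(A)-\nu(A)|$ over measurable $A\subset[-1,1]$, and $W(\mathbb{P},\mathbb{Q})=\sup\{|\int h\,d\mathbb{P}-\int h\,d\mathbb{Q}|: h:[-1,1]\to\mathbb{R}\text{ 1-Lipschitz}\}$. For $\varphi:\mathcal{M}_+\to\mathbb{R}$, $\|\varphi\|_{\mathrm{Lip},\mathrm{TV}}$ denotes its Lipschitz constant with respect to $\mathrm{TV}$. For an integer $K\ge1$, $D_K=\{i/2^K: i\in\mathbb{Z},\ -2^K\le i<2^K\}$, so $|D_K|=2^{K+1}$; vectors in $\mathbb{R}^{D_K}$ are indexed by $D_K$. For $x\in\mathbb{R}_{\ge0}^{D_K}$ let $\mu_x^{(K)}=\frac1{|D_K|}\sum_{k\in D_K}x_k\delta_k$; for $\varphi:\mathcal{M}_+\to\mathbb{R}$, $\varphi^{(K)}(x)=\varphi(\mu_x^{(K)})$. For $\mu\in\mathcal{M}_+$, $x^{(K)}(\mu)=(|D_K|\,\mu(I_k))_{k\in D_K}$, where $I_k=[k,k+2^{-K})$ for $k\neq 1-2^{-K}$ and $I_{1-2^{-K}}=[1-2^{-K},1]$. Normalized norms on $\mathbb{R}^d$ (with $d=|D_K|$ for $\mathbb{R}^{D_K}$):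 $\|x\|_1=\frac1d\sum_k|x_k|$ and $\|y\|_{1,*}=\max_k d|y_k|$. For $h:\mathbb{R}_{\ge0}^d\to\mathbb{R}$, $\|h\|_{\mathrm{Lip},1}=\sup_{x\ne x'}|h(x)-h(x')|/\|x-x'\|_1$. Inequalities between vectors are coordinatewise. With $G^{(K)}=|D_K|^{-2}(g(kk'))_{k,k'\in D_K}$: $\mathcal{K}_{=a,K}=\{G^{(K)}x: x\in\mathbb{R}_{\ge0}^{D_K},\ \|x\|_1=a\}$ and $\mathcal{K}_{=a,K}'=\{y+w: y\in\mathcal{K}_{=a,K},\ \|w\|_{1,*}\le|D_K|^{-1/2}\}$. (H3') means that the a.e. defined gradient of the Lipschitz function $\psi^{(K)}$ lies in $\mathcal{K}_{=a,K}'$ almost everywhere. Solution for a positive kernel. Let $q:[-1,1]\to\mathbb{R}$ be a continuously differentiable kernel with $q\ge m>0$ and $\varphi:\mathcal{M}_+\to\mathbb{R}$ an initial condition. Put $Q^{(K)}=|D_K|^{-2}(q(kk'))_{k,k'\in D_K}$, $\mathcal{C}_K=\{Q^{(K)}x: x\in\mathbb{R}_{\ge0}^{D_K}\}$, $\mathsf{C}_K(Q^{(K)}x)=\frac12Q^{(K)}x\cdot x$ (well-defined on $\mathcal{C}_K$). For $R>0$ define $\widetilde{\mathsf C}_{K,R}:\mathcal{C}_K\to\mathbb{R}$ by $\widetilde{\mathsf C}_{K,R}(y)=\max\big(\mathsf{C}_K(y),\frac{8R}{m}(\|y\|_{1,*}-R)\big)$ if $\|y\|_{1,*}\le2R$ and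 $\widetilde{\mathsf C}_{K,R}(y)=\frac{8R}{m}(\|y\|_{1,*}-R)$ otherwise, and $\mathsf{H}_{K,R}(y)=\inf\{\widetilde{\mathsf C}_{K,R}(w): w\in\mathcal{C}_K,\ w\ge y\}$ for $y\in\mathbb{R}^{D_K}$. Let $f_R^{(K)}\in\mathfrak{L}_{\mathrm{unif}}$ be the unique viscosity solution of $\partial_tf=\mathsf{H}_{K,R}(\nabla f)$ on $\mathbb{R}_{>0}\times\mathbb{R}_{>0}^{D_K}$ with $f(0,\cdot)=\varphi^{(K)}$. The solution to the infinite-dimensional Hamilton-Jacobi equation with kernel $q$ and initial condition $\varphi$ is $f(t,\mu)=\lim_{K\to\infty}f_R^{(K)}(t,x^{(K)}(\mu))$ for any $R>\|\varphi\|_{\mathrm{Lip},\mathrm{TV}}$. Existence and uniqueness of $f^{(K)}_R$, and existence, finiteness and $R$-independence of the limit, hold whenever $\varphi$ satisfies (H2), (H4) (with $\varphi$ in place of $\psi$) and, for some $a'>0$ and every $K\ge1$, $\nabla\varphi^{(K)}$ lies a.e. in $\{Q^{(K)}x+w: x\in\mathbb{R}_{\ge0}^{D_K},\|x\|_1\le a',\|w\|_{1,*}\le|D_K|^{-1/2}\}$; these conditions hold for $q=\widetilde g_b$, $\varphi=\widetilde\psi_b$, $a'=a$ under the hypotheses of the claim. Function spaces: for $u:[0,\infty)\times\mathbb{R}_{\ge0}^d\to\mathbb{R}$, $[u]_0=\sup_{t>0,x}|u(t,x)-u(0,x)|/t$; $\mathfrak{L}$ is the set of such $u$ with $u(0,\cdot)$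 Lipschitz and $[u]_0<\infty$; $\mathfrak{L}_{\mathrm{unif}}=\{u\in\mathfrak{L}:\sup_{t\ge0}\|u(t,\cdot)\|_{\mathrm{Lip},1}<\infty\}$. Viscosity solutions: a continuous function $f$ is a viscosity solution of $\partial_tf=\mathsf{H}(\nabla f)$ on $\mathbb{R}_{>0}\times\mathbb{R}_{>0}^d$ if for every $\phi\in C^\infty((0,\infty)\times\mathbb{R}_{>0}^d)$ and $(t^*,x^* )\in(0,\infty)\times\mathbb{R}_{>0}^d$: $(\partial_t\phi-\mathsf{H}(\nabla\phi))(t^*,x^* )\le0$ whenever $f-\phi$ has a local maximum at $(t^*,x^* )$, and $\ge0$ whenever $f-\phi$ has a local minimum there. *)

(* Defs.v *)
From HB Require Import structures.
From mathcomp Require Import all_boot all_order all_algebra.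
From mathcomp Require Import all_classical all_reals all_analysis.

Set Implicit Arguments.
Unset Strict Implicit.
Unset Printing Implicit Defensive.

Import Order.TTheory GRing.Theory Num.Theory.
Import numFieldNormedType.Exports.

Local Open Scope classical_set_scope.
Local Open Scope ring_scope.

Definition I11 {R : realType} : set R := [set` `[-1, 1]].

Section calculus.
Context {R : realType}.
Implicit Types (d : nat).

Definition nonneg d : set 'cV[R]_d := [set x | forall k, 0 <= x k 0].
Definition positive d : set 'cV[R]_d := [set x | forall k, 0 < x k 0].

Definition dotp d (x y : 'cV[R]_d) : R := \sum_k x k 0 * y k 0.

(* The norm ||.||_1 is normalized by 1/d; norm1d is its dual norm for dotp. *)
Definition norm1 d (x : 'cV[R]_d) : R := d%:R^-1 * \sum_k `|x k 0|.
Definition norm1d d (y : 'cV[R]_d) : R := \big[Num.max/0]_k (d%:R * `|y k 0|).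

Definition lip1 d (h : 'cV[R]_d -> R) : \bar R :=
  ereal_sup [set (`|h z.1 - h z.2| / norm1 (z.1 - z.2))%:E | z in
    [set z : 'cV[R]_d * 'cV[R]_d | [/\ nonneg z.1, nonneg z.2 & z.1 <> z.2]]].

(* Outer Lebesgue measure zero in R^d, by countable covers with boxes. *)
Definition lebesgue_null d (N : set 'cV[R]_d) : Prop :=
  forall e : R, 0 < e -> exists lo hi : nat -> 'cV[R]_d,
    [/\ forall n k, lo n k 0 <= hi n k 0,
        N `<=` \bigcup_n [set x | forall k, lo n k 0 <= x k 0 <= hi n k 0] &
        (\sum_(0 <= n <oo) (\prod_k (hi n k 0 - lo n k 0))%:E <= e%:E)%E].

Definition grad d (h : 'cV[R]_d -> R) (x : 'cV[R]_d) : 'cV[R]_d :=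
  \col_k 'D_(delta_mx k 0) h x.

(* For open U in a finite-dimensional V. *)
Fixpoint Cn (n : nat) (V : normedModType R) (U : set V) (f : V -> R) : Prop :=
  if n is m.+1 then
    (forall x, U x -> differentiable f x) /\ (forall v, Cn m U ('D_v f))
  else forall x, U x -> {for x, continuous f}.

Definition smooth (V : normedModType R) (U : set V) (f : V -> R) : Prop :=
  forall n, Cn n U f.

(* C^1 up to the endpoints, where the derivatives are one-sided. *)
Definition C1_itv (g : R -> R) : Prop :=
  exists2 g' : R -> R, {within I11, continuous g'} &
    forall x : R, x \in `[-1, 1] ->
      (g y - g x) / (y - x) @[y --> within I11 x^'] --> g' x.

End calculus.

Section hamilton_jacobi.
Context {R : realType} {d : nat}.
Implicit Types (u : R -> 'cV[R]_d -> R) (phi : R * 'cV[R]_d -> R).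

Definition interior_domain : set (R * 'cV[R]_d) :=
  [set z | 0 < z.1 /\ positive z.2].
Definition closed_domain : set (R * 'cV[R]_d) :=
  [set z | 0 <= z.1 /\ nonneg z.2].

Definition dt phi (z : R * 'cV[R]_d) : R := 'D_((1 : R), (0 : 'cV[R]_d)) phi z.
Definition dx phi (z : R * 'cV[R]_d) : 'cV[R]_d :=
  \col_k 'D_((0 : R), (delta_mx k 0 : 'cV[R]_d)) phi z.

Definition viscosity_solution (H : 'cV[R]_d -> R) u : Prop :=
  {within closed_domain, continuous (fun z => u z.1 z.2)} /\
  forall phi, smooth interior_domain phi -> forall z0, interior_domain z0 ->
    ((\forall z \near z0, u z.1 z.2 - phi z <= u z0.1 z0.2 - phi z0) ->
      dt phi z0 - H (dx phi z0) <= 0) /\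
    ((\forall z \near z0, u z.1 z.2 - phi z >= u z0.1 z0.2 - phi z0) ->
      dt phi z0 - H (dx phi z0) >= 0).

Definition seminorm0 u : \bar R :=
  ereal_sup [set (`|u z.1 z.2 - u 0 z.2| / z.1)%:E | z in
    [set z : R * 'cV[R]_d | 0 < z.1 /\ nonneg z.2]].

Definition L_space u : Prop :=
  (lip1 (u 0%R) < +oo)%E /\ (seminorm0 u < +oo)%E.

Definition L_unif u : Prop :=
  L_space u /\ (ereal_sup [set lip1 (u t) | t in [set t : R | 0 <= t]%R] < +oo)%E.

End hamilton_jacobi.

(* A finite measure on [-1, 1], seen as a measure on the real line giving no
   mass to the complement. *)
Record Mplus (R : realType) := {
  Mplus_measure :> {finite_measure set R -> \bar R} ;
  Mplus_supp : Mplus_measure (~` I11) = 0%E }.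

Section measures.
Context {R : realType}.
Implicit Types (mu nu : Mplus R) (phi : Mplus R -> R).

Definition mass mu : R := fine (mu I11).

Definition TV mu nu : R :=
  sup [set `|fine (mu A) - fine (nu A)| | A in
    [set A : set R | measurable A /\ A `<=` I11]].

Definition W mu nu : R :=
  sup [set `|(\int[mu]_(x in I11) h x) -
             (\int[nu]_(x in I11) h x)| | h in
    [set h : R -> R | 1.-lipschitz_(I11) h]].

(* The least Lipschitz constant, +oo if there is none. *)
Definition lipTV phi : \bar R :=
  ereal_inf [set L%:E | L in
    [set L : R | 0 <= L /\ forall mu nu, `|phi mu - phi nu| <= L * TV mu nu]].

Definition H2 phi : Prop :=
  lipTV phi \is a fin_num /\
  forall mu nu, `|phi mu - phi nu| <= fine (lipTV phi) * TV mu nu.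

Definition H4 phi : Prop :=
  exists L : R, forall mu nu, mass mu = 1 -> mass nu = 1 ->
    `|phi mu - phi nu| <= L * W mu nu.

End measures.

Section discretization.
Context {R : realType} (K : nat).

Definition card_D : nat := (2 ^ K.+1)%N.

(* 'I_card_D indexes D_K increasingly. *)
Definition dyadic (k : 'I_card_D) : R := k%:R / 2 ^+ K - 1.

Definition cell (k : 'I_card_D) : set R :=
  if k.+1 == card_D then [set` `[dyadic k, 1]]
  else [set` `[dyadic k, dyadic k + 2 ^- K[].

Lemma dyadic_itv (k : 'I_card_D) : dyadic k \in `[-1, 1].
Proof.
rewrite in_itv /= /dyadic lerDr divr_ge0 ?exprn_ge0 //= lerBlDr.
rewrite ler_pdivrMr ?exprn_gt0 // -(natrD R 1 1) -natrX -natrM ler_nat.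
by rewrite addn1 -expnS ltnW.
Qed.

(* For x in the nonnegative orthant Num.max 0 (x k 0) is x k 0; the truncation
   only makes mu_x total. *)
Lemma weight_ge0 (x : 'cV[R]_card_D) k :
  0 <= card_D%:R^-1 * Num.max 0 (x k 0).
Proof. by rewrite mulr_ge0 ?invr_ge0 ?ler0n // le_max lexx. Qed.

Definition weight (x : 'cV[R]_card_D) (k : 'I_card_D) : {nonneg R} :=
  NngNum (weight_ge0 x k).

Definition atom (x : 'cV[R]_card_D) (n : nat) :
    {finite_measure set R -> \bar R} :=
  if insub n is Some k then mscale (weight x k) (dirac (dyadic k)) else mzero.

Definition atomic_measure (x : 'cV[R]_card_D) := msum (atom x) card_D.

HB.instance Definition _ x := Measure.on (atomic_measure x).

Lemma atomic_measureE x (A : set R) :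
  atomic_measure x A =
  (card_D%:R^-1%:E * \sum_k (Num.max 0 (x k 0))%:E * \d_(dyadic k) A)%E.
Proof.
rewrite ge0_sume_distrr => [|k _]; last by rewrite mule_ge0 // lee_fin le_max lexx.
rewrite /atomic_measure /msum; apply: eq_bigr => k _.
by rewrite /atom valK /= /mscale /= EFinM muleA.
Qed.

Lemma atomic_measure_fin x : fin_num_fun (atomic_measure x).
Proof.
move=> A mA; rewrite /atomic_measure /msum; apply/sum_fin_numP => i _ _.
exact: fin_num_measure.
Qed.

HB.instance Definition _ x :=
  Measure_isFinite.Build _ _ _ (atomic_measure x) (atomic_measure_fin x).

Lemma atomic_measure_supp x : atomic_measure x (~` I11) = 0%E.
Proof.
rewrite atomic_measureE big1 ?mule0 // => k _.
rewrite diracE memNset ?mule0 //= => /(_ _); apply.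
exact: dyadic_itv.
Qed.

Definition mu_of (x : 'cV[R]_card_D) : Mplus R :=
  Build_Mplus (atomic_measure_supp x).

Definition discretize (phi : Mplus R -> R) (x : 'cV[R]_card_D) : R := phi (mu_of x).

Definition x_of (mu : Mplus R) : 'cV[R]_card_D :=
  \col_k (card_D%:R * fine (mu (cell k))).

Definition kmx (q : R -> R) : 'M[R]_card_D :=
  \matrix_(k, k') ((card_D%:R ^+ 2)^-1 * q (dyadic k * dyadic k')).

Definition K_eq (g : R -> R) (a : R) : set 'cV[R]_card_D :=
  [set kmx g *m x | x in [set x | nonneg x /\ norm1 x = a]].

Definition K_eq' (g : R -> R) (a : R) : set 'cV[R]_card_D :=
  [set z.1 + z.2 | z in [set z : 'cV[R]_card_D * 'cV[R]_card_D |
    K_eq g a z.1 /\ norm1d z.2 <= (Num.sqrt card_D%:R)^-1]].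

Definition cone (q : R -> R) : set 'cV[R]_card_D :=
  [set kmx q *m x | x in @nonneg R card_D].

(* The value does not depend on the chosen preimage x of y, as Q is symmetric. *)
Definition C_fun (q : R -> R) (y : 'cV[R]_card_D) : R :=
  let x := xget 0 [set x | nonneg x /\ kmx q *m x = y] in
  2^-1 * dotp (kmx q *m x) x.

Definition C_tilde (q : R -> R) (m r : R) (y : 'cV[R]_card_D) : R :=
  let l := 8 * r / m * (norm1d y - r) in
  if norm1d y <= 2 * r then Num.max (C_fun q y) l else l.

Definition H_fun (q : R -> R) (m r : R) (y : 'cV[R]_card_D) : R :=
  inf [set C_tilde q m r w | w in
    [set w | cone q w /\ forall k, y k 0 <= w k 0]].

Definition finite_solution (q : R -> R) (m r : R) (phi : Mplus R -> R)
    (u : R -> 'cV[R]_card_D -> R) : Prop :=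
  [/\ L_unif u, viscosity_solution (H_fun q m r) u &
      forall x, nonneg x -> u 0 x = discretize phi x].

(* Uniqueness is that of a function on [0, +oo) x R_{>=0}^D_K. *)
Definition the_finite_solution (q : R -> R) (m r : R) (phi : Mplus R -> R)
    (u : R -> 'cV[R]_card_D -> R) : Prop :=
  finite_solution q m r phi u /\
  forall v, finite_solution q m r phi v ->
    forall t x, 0 <= t -> nonneg x -> u t x = v t x.

End discretization.

Section equation.
Context {R : realType}.
Implicit Types (g q : R -> R) (phi psi : Mplus R -> R) (a b : R).

(* Rademacher's theorem gives differentiability a.e. when psi satisfies H2; it
   is part of the predicate here. *)
Definition H3' g psi a : Prop :=
  0 < a /\ forall K, (1 <= K)%N ->
    lebesgue_null [set x : 'cV[R]_(card_D K) | nonneg x /\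
      ~ (differentiable (discretize psi) x /\ K_eq' g a (grad (discretize psi) x))].

Definition positive_kernel q : Prop := forall z, z \in `[-1, 1] -> 0 < q z.

(* m is the lower bound of q that enters the truncated Hamiltonians; r is the
   truncation radius, any r above the Lipschitz constant of phi being allowed.
   The values at K = 0 are irrelevant to the limit. *)
Definition hj_solution q phi (f : R -> Mplus R -> R) : Prop :=
  exists m : R, [/\ 0 < m, forall z, z \in `[-1, 1] -> m <= q z &
    forall r : R, (lipTV phi < r%:E)%E ->
      exists2 u : forall K, R -> 'cV[R]_(card_D K) -> R,
        forall K, (1 <= K)%N -> the_finite_solution q m r phi (u K) &
        forall t mu, 0 <= t -> u K t (x_of K mu) @[K --> \oo] --> f t mu].

Definition shift_kernel g b : R -> R := fun z => g z + b.

Definition shift_init psi a b : Mplus R -> R := fun mu => psi mu + a * b * mass mu.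

Definition unshift (f : R -> Mplus R -> R) a b : R -> Mplus R -> R :=
  fun t mu => f t mu - a * b * mass mu - a ^+ 2 * b * t / 2.

End equation.

(* Main.v *)
Require Import Defs.
From HB Require Import structures.
From mathcomp Require Import all_boot all_order all_algebra.
From mathcomp Require Import all_classical all_reals all_analysis.
From mathcomp Require Import measurable_realfun ring lra.

Set Implicit Arguments.
Unset Strict Implicit.
Unset Printing Implicit Defensive.

Import Order.TTheory GRing.Theory Num.Theory.
Import numFieldNormedType.Exports.

Local Open Scope classical_set_scope.
Local Open Scope ring_scope.

(** Why the shift [b] is invisible in the limit.  Fix a resolution [K], write
    [d] for the number of dyadic points, [G] for the matrix of the kernel [g],
    and let [u_b] be the viscosity solution attached to [g + b].  Removing its
    expected linear part, [v_b t x = u_b t x - a b |x|_1 - a^2 b t / 2] starts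
    from the discretization of [psi], whatever [b] is, and solves the equation
    with nonlinearity [F_b p = H_b (p + a b / d) - a^2 b / 2].  On vectors
    [p = G x + w] with [x >= 0], [|x|_1 = a] and [w] of dual norm at most [rho],
    the shift of the kernel adds the constant vector [a b / d] to [G x] and
    [a^2 b / 2] to the energy [G x . x / 2], so both corrections cancel and
    [F_b p = G x . x / 2 + O (rho)] with an error uniform in [K]
    ([shifted_H_near_cone]).  Thus [v_b] and [v_b'] have the same initial value
    and, up to [O (d^(-1/2))], the same nonlinearity on the set [K'] in which
    the gradient of the discretized [psi] takes its values.

    It remains to see that only gradients in [K'] matter.  Let [sigma] be the
    support function of [K'].  The almost everywhere constraint on the gradient
    amounts to [psi x - psi x' <= sigma (x - x')] for all [x] and [x'].  A
    doubling of variables then proves the stronger inequality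
    [v_b t x - v_b' t x' <= sigma (x - x') + kappa t], with [kappa] the
    discrepancy of the two nonlinearities on [K']: at a maximum point of the
    difference, the gradients seen by both equations are a gradient of [sigma],
    hence a point of [K'].  Taking [x = x'] gives [v_b - v_b' <= kappa t], and
    exchanging [b] and [b'] gives the other bound.  Since [kappa] is of order
    [2^(-K/2)], the limits agree ([unshift_le]).

    Three points make this work with test functions that are quadratic
    polynomials ([viscosity_upper_jet], [jet_comparison]).  The function [sigma]
    is replaced by [gauge], where a log-sum-exp stands for a maximum and
    [sqrt (ep^2 + s^2)] for an absolute value: its gradient belongs to [K'] and
    it lies locally below quadratic polynomials.  The boundary of the orthant is
    avoided by the penalty [eta / x_k], whose derivative may be discarded because
    the nonlinearities are nondecreasing, and large times by [tau t^2], whose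
    derivative has the favorable sign in both equations.  Large [x] are excluded
    by a linear term of small slope [alpha], since the initial inequality bounds
    the difference to be maximized independently of [x].

    The passage from the gradient to increments ([increment_le_of_gradient])
    follows a segment translated by a small vector.  Translating one coordinate
    after the other and using Tonelli's theorem each time, one finds a
    translation for which the segment spends little time in the boxes that cover
    the exceptional null set ([good_shift_seq]); the remaining time costs at most
    the Lipschitz constant times its length ([growth_outside_open]). *)

(** * Quadratic test functions *)

Lemma Cn_subset (R : realType) (V : normedModType R) n (U : set V) (f : V -> R) :
  Cn n setT f -> Cn n U f.
Proof.
by elim: n f => [|n IH] f /=; [move=> h x _; exact: h|
  move=> [h1 h2]; split=> [x _|v]; [exact: h1|exact: IH]].
Qed.

Lemma Cn_pred (R : realType) (V : normedModType R) n (U : set V) (f : V -> R) :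
  Cn n.+1 U f -> Cn n U f.
Proof.
elim: n f => [|n IH] f.
  by move=> [df _] x Ux; exact: differentiable_continuous (df x Ux).
by move=> [df Df]; split=> // v; exact: IH (Df v).
Qed.

Lemma Cn_cst (R : realType) (V : normedModType R) n (c : R) :
  Cn n [set: V] (cst c).
Proof.
elim: n c => [|n IH] c; first by move=> x _; exact: cst_continuous.
split=> [x _|v]; first exact: differentiable_cst.
suff -> : 'D_v (cst c : V -> R) = cst 0 by exact: IH.
by apply/funext => x; rewrite derive_cst.
Qed.

Lemma Cn_add (R : realType) (V : normedModType R) n (f g : V -> R) :
  Cn n setT f -> Cn n setT g -> Cn n setT (f \+ g).
Proof.
elim: n f g => [|n IH] f g /=.
  by move=> hf hg x _; apply: continuousD; [exact: hf|exact: hg].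
move=> [df Df] [dg Dg]; split=> [x _|v].
  by apply: differentiableD; [exact: df|exact: dg].
suff -> : 'D_v (f \+ g) = 'D_v f \+ 'D_v g by exact: IH.
apply/funext => x /=.
have dfx := df x I; have dgx := dg x I.
by rewrite deriveD //; exact: diff_derivable.
Qed.

Lemma Cn_mul (R : realType) (V : normedModType R) n (f g : V -> R) :
  Cn n setT f -> Cn n setT g -> Cn n setT (f \* g).
Proof.
elim: n f g => [|n IH] f g.
  by move=> hf hg x _; apply: continuousM; [exact: hf|exact: hg].
move=> Cf Cg; have [Cf' Cg'] := (Cn_pred Cf, Cn_pred Cg).
move: Cf Cg => [df Df] [dg Dg]; split=> [x _|v].
  by apply: differentiableM; [exact: df|exact: dg].
suff -> : 'D_v (f \* g) = (f \* 'D_v g) \+ (g \* 'D_v f).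
  by apply: Cn_add; apply: IH => //; [exact: Dg|exact: Df].
apply/funext => x /=.
have dfx := df x I; have dgx := dg x I.
by rewrite deriveM //; exact: diff_derivable.
Qed.

Lemma Cn_sum (R : realType) (V : normedModType R) n (I : Type) (r : seq I)
    (F : I -> V -> R) :
  (forall i, Cn n setT (F i)) -> Cn n setT (fun x => \sum_(i <- r) F i x).
Proof.
move=> CF; elim: r => [|i r IH].
  by under [X in Cn _ _ X]funext do rewrite big_nil; exact: Cn_cst.
by under [X in Cn _ _ X]funext do rewrite big_cons; exact: Cn_add.
Qed.

(** A function that is its own derivative in every direction has constant
    directional derivatives, so all later ones vanish. *)
Lemma Cn_additive (R : realType) (V : normedModType R) n (f : V -> R) :
  (forall x, differentiable f x) -> (forall x v : V, 'D_v f x = f v) ->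
  Cn n setT f.
Proof.
move=> df Df; case: n => [|n]; first by move=> x _; exact/differentiable_continuous/df.
split=> // v; suff -> : 'D_v f = cst (f v) by exact: Cn_cst.
by apply/funext => x; rewrite Df.
Qed.

Section spacetime.
Context {R : realType} {d : nat}.
Local Notation V := (R * 'cV[R]_d)%type.

Lemma time_is_derive (z v : V) : is_derive z v (fun y : V => y.1) v.1.
Proof.
have df : differentiable (fst : V -> R) z.
  by apply: linear_differentiable => ?; exact: cvg_fst.
apply: DeriveDef; first exact: diff_derivable.
by rewrite deriveE // diff_lin // => ?; exact: cvg_fst.
Qed.

Lemma space_is_derive k (z v : V) :
  is_derive z v (fun y : V => y.2 k 0) (v.2 k 0).
Proof.
have @f : {linear V -> R}.
  by exists (fun y : V => y.2 k 0); do 2![eexists]; do ?[constructor];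
    rewrite ?mxE// => ? *; rewrite ?mxE//; move=> ?; rewrite !mxE.
have cf : continuous f.
  move=> y; apply: (@continuous_comp _ _ _ snd (fun M : 'cV[R]_d => M k 0)).
    exact: cvg_snd.
  exact: coord_continuous.
have df : differentiable f z by exact: linear_differentiable.
rewrite (_ : (fun _ => _) = f) //.
apply: DeriveDef; first exact: diff_derivable.
by rewrite deriveE // diff_lin.
Qed.

End spacetime.

Definition quadratic_at {R : realType} {d : nat} (z0 : R * 'cV[R]_d) (b : R)
    (p : 'cV[R]_d) (C : R) (z : R * 'cV[R]_d) : R :=
  b * (z.1 - z0.1) + \sum_k p k 0 * (z.2 k 0 - z0.2 k 0) +
  C * ((z.1 - z0.1) ^+ 2 + \sum_k (z.2 k 0 - z0.2 k 0) ^+ 2).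

(** The pair [(b, p)] is a superdifferential of [f] at [z0], with a quadratic
    instead of a merely superlinear remainder: the majorant is then a polynomial
    and can serve as a test function.  Subdifferentials of [f] are those of [- f]
    with the opposite sign. *)
Definition upper_jet {R : realType} {d : nat} (f : R * 'cV[R]_d -> R)
    (z0 : R * 'cV[R]_d) (b : R) (p : 'cV[R]_d) : Prop :=
  exists C, \forall z \near z0, f z <= f z0 + quadratic_at z0 b p C z.

Section jets.
Context {R : realType} {d : nat}.
Local Notation V := (R * 'cV[R]_d)%type.
Implicit Types (f g : V -> R) (z : V) (p q : 'cV[R]_d).

Lemma quadratic0 z b p C : quadratic_at z b p C z = 0.
Proof.
rewrite /quadratic_at subrr mulr0 expr0n /= add0r !big1 ?addr0 ?mulr0 ?addr0 // => k _;
by rewrite subrr ?expr0n ?mulr0.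
Qed.

Lemma quadraticD z0 b b' p p' C C' z :
  quadratic_at z0 b p C z + quadratic_at z0 b' p' C' z = quadratic_at z0 (b + b') (p + p') (C + C') z.
Proof.
rewrite /quadratic_at [in RHS](eq_bigr (fun k => p k 0 * (z.2 k 0 - z0.2 k 0) +
  p' k 0 * (z.2 k 0 - z0.2 k 0))) ?big_split /=; last first.
  by move=> k _; rewrite mxE mulrDl.
by set A := \sum_k _; set B := \sum_k _; set D := \sum_k _; ring.
Qed.

Lemma quadraticN z0 b p C z : - quadratic_at z0 b p C z = quadratic_at z0 (- b) (- p) (- C) z.
Proof.
apply/eqP; rewrite eq_sym -addr_eq0 quadraticD !addNr /quadratic_at !mul0r addr0 add0r.
by rewrite big1 // => k _; rewrite mxE mul0r.
Qed.

Lemma upper_jetD f g z0 b b' p p' :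
  upper_jet f z0 b p -> upper_jet g z0 b' p' ->
  upper_jet (f \+ g) z0 (b + b') (p + p').
Proof.
move=> [C hf] [C' hg]; exists (C + C'); near=> z.
rewrite -quadraticD /= addrACA lerD //; [near: z; exact: hf|near: z; exact: hg].
Unshelve. all: by end_near. Qed.

Lemma upper_jet_ext (f g : V -> R) z0 b b' p p' : upper_jet f z0 b p ->
  f =1 g -> b = b' -> p = p' -> upper_jet g z0 b' p'.
Proof. by move=> + /funext <- <- <-. Qed.

(** Where [f - g] is locally maximal, [f] lies below a translate of [g]. *)
Lemma upper_jet_max f g z0 b p :
  (\forall z \near z0, f z - g z <= f z0 - g z0) ->
  upper_jet g z0 b p -> upper_jet f z0 b p.
Proof.
move=> fg [C hg]; exists C; near=> z.
have : f z - g z <= f z0 - g z0 by near: z; exact: fg.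
have : g z <= g z0 + quadratic_at z0 b p C z by near: z; exact: hg.
lra.
Unshelve. all: by end_near. Qed.

Lemma quadratic_smooth z0 b p C : smooth interior_domain (quadratic_at z0 b p C).
Proof.
move=> n; apply: Cn_subset.
have Ctime : Cn n [set: V] (fun z : V => z.1 - z0.1).
  apply: (@Cn_add _ _ n (fun z : V => z.1) (cst (- z0.1))); last exact: Cn_cst.
  apply: Cn_additive => [x|x v].
    by apply: linear_differentiable => ?; exact: cvg_fst.
  by have H := time_is_derive x v; rewrite derive_val.
have Cspace k : Cn n [set: V] (fun z : V => z.2 k 0 - z0.2 k 0).
  apply: (@Cn_add _ _ n (fun z : V => z.2 k 0) (cst (- z0.2 k 0))); last exact: Cn_cst.
  apply: Cn_additive => [x|x v].
    apply: (@differentiable_comp _ _ _ _ snd (fun M : 'cV[R]_d => M k 0)).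
      by apply: linear_differentiable => ?; exact: cvg_snd.
    exact: differentiable_coord.
  by have H := space_is_derive k x v; rewrite derive_val.
apply: Cn_add; last first.
  apply: (@Cn_mul _ _ _ (cst C)); first exact: Cn_cst.
  apply: Cn_add; first exact: Cn_mul.
  by apply: Cn_sum => k; exact: Cn_mul.
apply: Cn_add; first by apply: (@Cn_mul _ _ _ (cst b)) => //; exact: Cn_cst.
by apply: Cn_sum => k; apply: (@Cn_mul _ _ _ (cst (p k 0))) => //; exact: Cn_cst.
Qed.

Lemma quadratic_is_derive z0 b p C v :
  is_derive z0 v (quadratic_at z0 b p C) (b * v.1 + \sum_k p k 0 * v.2 k 0).
Proof.
have Dt : is_derive z0 v (fun z : V => z.1 - z0.1) v.1.
  apply: (is_derive_eq (is_deriveB (time_is_derive z0 v) (is_derive_cst z0.1 z0 v))).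
  by rewrite subr0.
have Dx k : is_derive z0 v (fun z : V => z.2 k 0 - z0.2 k 0) (v.2 k 0).
  apply: (is_derive_eq (is_deriveB (space_is_derive k z0 v)
    (is_derive_cst (z0.2 k 0) z0 v))).
  by rewrite subr0.
have Dsq (f : V -> R) l : is_derive z0 v f l -> f z0 = 0 ->
    is_derive z0 v (fun z => f z ^+ 2) 0.
  move=> Df f0; apply: (is_derive_eq (is_deriveM Df Df)).
  by rewrite f0 !scale0r addr0.
have Dsc (f : V -> R) c l : is_derive z0 v f l ->
    is_derive z0 v (fun z => c * f z) (c * l).
  by move=> Df; exact: (is_deriveZ c Df).
have Dsum (F : 'I_d -> V -> R) (l : 'I_d -> R) :
    (forall k, is_derive z0 v (F k) (l k)) ->
    is_derive z0 v (fun z => \sum_k F k z) (\sum_k l k).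
  move=> DF; have -> : (fun z => \sum_k F k z) = \sum_k F k.
    by apply/funext => z; rewrite fct_sumE.
  exact: is_derive_sum.
have D1 := Dsc _ b _ Dt.
have D2 := Dsum _ _ (fun k => Dsc _ (p k 0) _ (Dx k)).
have D3 := Dsum _ _ (fun k => Dsq _ _ (Dx k) (subrr _)).
have D4 := Dsq _ _ Dt (subrr _).
apply: (is_derive_eq (is_deriveD (is_deriveD D1 D2) (Dsc _ C _ (is_deriveD D4 D3)))).
by rewrite big1_eq add0r mulr0 addr0.
Qed.

Lemma dt_quadratic z0 b p C : dt (quadratic_at z0 b p C) z0 = b.
Proof.
rewrite /dt; have H := quadratic_is_derive z0 b p C (1, 0); rewrite derive_val /=.
by rewrite mulr1 big1 ?addr0 // => k _; rewrite mxE mulr0.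
Qed.

Lemma dx_quadratic z0 b p C : dx (quadratic_at z0 b p C) z0 = p.
Proof.
apply/matrixP => k j; rewrite ord1 mxE.
have H := quadratic_is_derive z0 b p C (0, delta_mx k 0); rewrite derive_val /=.
rewrite mulr0 add0r (bigD1 k) //= big1 ?addr0 ?mxE ?eqxx ?mulr1 // => i ik.
by rewrite mxE (negbTE ik) mulr0.
Qed.

(** The quadratic majorant is itself an admissible test function. *)
Lemma viscosity_upper_jet (H : 'cV[R]_d -> R) u z0 b p :
  viscosity_solution H u -> interior_domain z0 ->
  upper_jet (fun z => u z.1 z.2) z0 b p -> b <= H p.
Proof.
move=> [_ Hu] Iz0 [C hC].
have [+ _] := Hu _ (quadratic_smooth z0 b p C) _ Iz0.
rewrite dt_quadratic dx_quadratic subr_le0; apply.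
by rewrite quadratic0; apply: filterS hC => z; lra.
Qed.

Lemma viscosity_lower_jet (H : 'cV[R]_d -> R) u z0 b p :
  viscosity_solution H u -> interior_domain z0 ->
  upper_jet (fun z => - u z.1 z.2) z0 (- b) (- p) -> H p <= b.
Proof.
move=> [_ Hu] Iz0 [C hC].
have [_ +] := Hu _ (quadratic_smooth z0 b p (- C)) _ Iz0.
rewrite dt_quadratic dx_quadratic subr_ge0; apply.
rewrite quadratic0; apply: filterS hC => z.
by rewrite -[C in X in X -> _]opprK -quadraticN; lra.
Qed.

End jets.

(** * Jets of the penalizing terms *)

Section jet_examples.
Context {R : realType} {d : nat}.
Local Notation V := (R * 'cV[R]_d)%type.
Implicit Types (z : V) (p : 'cV[R]_d).

Lemma near_coord z0 (e : R) : 0 < e ->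
  nbhs z0 [set z : V | forall k, `|z.2 k 0 - z0.2 k 0| < e].
Proof.
move=> e0.
have h : nbhs z0 [set z : V | ball z0.2 e z.2].
  exact: (@cvg_snd _ _ (nbhs z0.1) (nbhs z0.2) _ _ (nbhsx_ballx z0.2 e e0)).
apply: filterS h => z /= zz k.
by case: zz => _ /(_ k ord0) /=; rewrite /ball /= distrC.
Qed.

Lemma near_time z0 (e : R) : 0 < e -> nbhs z0 [set z : V | `|z.1 - z0.1| < e].
Proof.
move=> e0.
have h : nbhs z0 [set z : V | ball z0.1 e z.1].
  exact: (@cvg_fst _ _ (nbhs z0.1) (nbhs z0.2) _ _ (nbhsx_ballx z0.1 e e0)).
by apply: filterS h => z /=; rewrite /ball /= distrC.
Qed.

(** The remainder has to dominate [c2 * (t - t0) ^+ 2] and may not be negative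
    in the space variables, whence the constant [`|c2|]. *)
Lemma upper_jet_time (c0 c1 c2 : R) z0 :
  upper_jet (fun z => c0 + c1 * z.1 + c2 * z.1 ^+ 2) z0 (c1 + c2 * z0.1 *+ 2) 0.
Proof.
exists `|c2|; near=> z; rewrite /quadratic_at (eq_bigr (fun=> 0)); last first.
  by move=> k _; rewrite mxE mul0r.
rewrite big1_eq addr0.
have h1 : c2 <= `|c2| by exact: ler_norm.
have h2 : 0 <= (z.1 - z0.1) ^+ 2 by exact: sqr_ge0.
have h3 : 0 <= \sum_k (z.2 k 0 - z0.2 k 0) ^+ 2.
  by apply: sumr_ge0 => k _; exact: sqr_ge0.
set s := \sum_k _ in h3 *; have h4 := mulr_ge0 (normr_ge0 c2) h3.
have h5 : c2 * (z.1 - z0.1) ^+ 2 <= `|c2| * (z.1 - z0.1) ^+ 2 by exact: ler_wpM2r.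
rewrite [`|c2| * _]mulrDr.
set A := `|c2| * s in h4 *; set B := `|c2| * _ ^+ 2 in h5 *.
have -> : c0 + c1 * z.1 + c2 * z.1 ^+ 2 = c0 + c1 * z0.1 + c2 * z0.1 ^+ 2 +
    (c1 + c2 * z0.1 *+ 2) * (z.1 - z0.1) + c2 * (z.1 - z0.1) ^+ 2 by ring.
lra.
Unshelve. all: by end_near. Qed.

Lemma upper_jet_linear (c : R) z0 :
  upper_jet (fun z => c * \sum_k z.2 k 0) z0 0 (const_mx c).
Proof.
exists 0; near=> z; rewrite /quadratic_at !mul0r add0r addr0.
rewrite !mulr_sumr -big_split /=; apply: ler_sum => k _.
by rewrite mxE mulrBr addrC subrK.
Unshelve. all: by end_near. Qed.

Lemma upper_jet_space (f : 'cV[R]_d -> R) z0 p (A e : R) : 0 < e ->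
  (forall y : 'cV[R]_d, (forall k, `|y k 0 - z0.2 k 0| < e) ->
    f y <= f z0.2 + \sum_k p k 0 * (y k 0 - z0.2 k 0)
           + A * \sum_k (y k 0 - z0.2 k 0) ^+ 2) ->
  upper_jet (fun z => f z.2) z0 0 p.
Proof.
move=> e0 fq; exists `|A|; near=> z.
have /fq : forall k, `|z.2 k 0 - z0.2 k 0| < e by near: z; exact: near_coord.
rewrite /quadratic_at mul0r add0r => /le_trans; apply; rewrite addrA lerD2l.
set s := \sum_k _ ^+ 2.
have s0 : 0 <= s by apply: sumr_ge0 => k _; exact: sqr_ge0.
rewrite mulrDr; apply: (@le_trans _ _ (`|A| * s)).
  by rewrite ler_wpM2r // ler_norm.
by rewrite lerDr mulr_ge0 // sqr_ge0.
Unshelve. all: by end_near. Qed.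

(** The exact remainder of the tangent at [x0] is [(x - x0)^2 / (x * x0^2)], and
    [x] is at least half of [x0]. *)
Lemma inv_upper_quadratic (x0 x : R) : 0 < x0 -> x0 / 2 <= x ->
  x^-1 <= x0^-1 - x0 ^- 2 * (x - x0) + 2 * x0 ^- 3 * (x - x0) ^+ 2.
Proof.
move=> x00 hx; have xp : 0 < x by lra.
have -> : x^-1 = x0^-1 - x0 ^- 2 * (x - x0) + x^-1 * x0 ^- 2 * (x - x0) ^+ 2.
  by field; rewrite !gt_eqF.
rewrite lerD2l ler_wpM2r ?sqr_ge0 //.
have -> : 2 * x0 ^- 3 = (x0 / 2)^-1 * x0 ^- 2 by field; rewrite gt_eqF.
apply: ler_wpM2r; first by rewrite invr_ge0 exprn_ge0 // ltW.
by rewrite lef_pV2 // posrE divr_gt0.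
Qed.

Lemma upper_jet_inv (c : R) z0 : 0 <= c -> positive z0.2 ->
  upper_jet (fun z => c * \sum_k (z.2 k 0)^-1) z0 0 (\col_k (- (c * z0.2 k 0 ^- 2))).
Proof.
move=> c0 z0p.
pose B := \sum_k 2 * z0.2 k 0 ^- 3.
have Bk k : 0 <= 2 * z0.2 k 0 ^- 3.
  by rewrite mulr_ge0 // invr_ge0 exprn_ge0 // ltW.
pose m := \big[Num.min/1]_k (z0.2 k 0 / 2).
have m0 : 0 < m by rewrite lt_bigmin // => k _; rewrite divr_gt0.
apply: (@upper_jet_space (fun y => c * \sum_k (y k 0)^-1) z0 _ (c * B) m m0).
move=> y hy; rewrite !mulr_sumr -!big_split /=; apply: ler_sum => k _.
rewrite mxE -mulr_sumr mulNr -!mulrA -mulrN -!mulrDr ler_wpM2l //.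
have /(inv_upper_quadratic (z0p k)) : z0.2 k 0 / 2 <= y k 0.
  have : `|y k 0 - z0.2 k 0| < z0.2 k 0 / 2.
    by apply: (lt_le_trans (hy k)); exact: bigmin_le_cond.
  rewrite ltr_norml; lra.
move=> /le_trans; apply; rewrite lerD2l ler_wpM2r ?sqr_ge0 //.
by rewrite /B (bigD1 k) //= lerDl sumr_ge0.
Qed.

End jet_examples.

(** * Comparison by doubling the variables *)

Lemma cV_box_compact (R : realType) d (lo hi : R) :
  compact [set x : 'cV[R]_d | forall k, lo <= x k 0 <= hi].
Proof.
have -> : [set x : 'cV[R]_d | forall k, lo <= x k 0 <= hi] =
    trmx @` [set v : 'rV[R]_d | forall k, `[lo, hi]%classic (v ord0 k)].
  apply/seteqP; split=> [x xb|_ [v vb <-] k]; last first.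
    by have := vb k; rewrite /= in_itv mxE.
  exists x^T; last by rewrite trmxK.
  by move=> k; rewrite /= in_itv mxE; exact: xb.
apply: continuous_compact; last first.
  by apply: (@rV_compact _ _ (fun=> `[lo, hi]%classic)) => k; exact: segment_compact.
apply: continuous_subspaceT => v A /= /nbhs_ballP[e e0 eA].
apply/nbhs_ballP; exists e => // w [_ vw]; apply: eA; split=> // i j.
by rewrite !mxE.
Qed.

Lemma within_continuous_comp (T U W : topologicalType) (A : set T) (B : set U)
    (f : T -> U) (g : U -> W) : continuous f -> (forall x, A x -> B (f x)) ->
  {within B, continuous g} -> {within A, continuous (g \o f)}.
Proof.
move=> cf AB /subspace_continuousP cg; apply/subspace_continuousP => x Ax S gS.
have gS' : nbhs (f x) [set y | B y -> S (g y)] by exact: cg (AB _ Ax) S gS.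
have fS : nbhs x (f @^-1` [set y | B y -> S (g y)]) by exact: cf gS'.
by apply: (@filterS _ (nbhs x) _ _ _ _ fS) => y /= yS Ay; exact/yS/AB.
Qed.

Lemma continuous_fin_sum (R : realType) (T : topologicalType) d
    (f : 'I_d -> T -> R) (x : T) :
  (forall k, {for x, continuous (f k)}) ->
  {for x, continuous (fun y => \sum_k f k y)}.
Proof.
move=> cf; rewrite /prop_for /continuous_at.
apply: (@cvg_big R _ +%R 0 xpredT _ T (nbhs x) (index_enum _) f (f^~ x)).
  by exact: add_continuous.
by move=> k _; exact: cf.
Qed.

Lemma le_sum_coord (R : realType) d (f : 'I_d -> R) k :
  (forall k, 0 <= f k) -> f k <= \sum_k f k.
Proof. by move=> f0; rewrite (bigD1 k) //= lerDl sumr_ge0. Qed.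

Section comparison.
Context {R : realType} {d : nat}.
Local Notation V := (R * 'cV[R]_d)%type.
Variables (v v' : R -> 'cV[R]_d -> R) (F F' : 'cV[R]_d -> R).
Variables (Th : 'cV[R]_d -> R) (DTh : 'cV[R]_d -> 'cV[R]_d).
Variables (C ka al0 : R).
Hypothesis C_gt0 : 0 < C.
Hypothesis al0_gt0 : 0 < al0.
Hypothesis vc : {within closed_domain, continuous (fun z : V => v z.1 z.2)}.
Hypothesis v'c : {within closed_domain, continuous (fun z : V => v' z.1 z.2)}.
Hypothesis vC : forall (t : R) (x : 'cV[R]_d),
  0 <= t -> nonneg x -> v t x - v 0 x <= C * t.
Hypothesis v'C : forall (t : R) (x : 'cV[R]_d),
  0 <= t -> nonneg x -> v' 0 x - v' t x <= C * t.
Hypothesis v_sub : forall z0 b p, interior_domain z0 ->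
  upper_jet (fun z : V => v z.1 z.2) z0 b p -> b <= F p.
Hypothesis v'_super : forall (z0 : V) (b : R) (p : 'cV[R]_d), interior_domain z0 ->
  upper_jet (fun z : V => - v' z.1 z.2) z0 (- b) (- p) -> F' p <= b.
Hypothesis F_mono : forall p q : 'cV[R]_d,
  (forall k, p k 0 <= q k 0) -> F p <= F q.
Hypothesis F'_mono : forall p q : 'cV[R]_d,
  (forall k, p k 0 <= q k 0) -> F' p <= F' q.
Hypothesis Th_cont : continuous Th.
Hypothesis Th_quad : forall z0 : 'cV[R]_d, exists A e : R, 0 < e /\
  forall h : 'cV[R]_d, (forall k, `|h k 0| < e) ->
    Th (z0 + h) <= Th z0 + \sum_k DTh z0 k 0 * h k 0 + A * \sum_k h k 0 ^+ 2.
Hypothesis init : forall x x' : 'cV[R]_d, nonneg x -> nonneg x' ->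
  v 0 x - v' 0 x' <= Th (x - x').
Hypothesis F_close : forall (z : 'cV[R]_d) (al : R), 0 < al -> al <= al0 ->
  F (DTh z + const_mx al) <= F' (DTh z - const_mx al) + ka.

Let diff_le (t : R) (x : 'cV[R]_d) (t' : R) (x' : 'cV[R]_d) :
  0 <= t -> 0 <= t' -> nonneg x -> nonneg x' ->
  v t x - v' t' x' - Th (x - x') <= C * t + C * t'.
Proof.
move=> t0 t'0 x0 x'0; have := vC t0 x0; have := v'C t'0 x'0; have := init x0 x'0.
lra.
Qed.

Section penalized.
Variables (ga ka' ta al et : R).
Hypothesis ga0 : 0 < ga.
Hypothesis ta0 : 0 < ta.
Hypothesis al_gt0 : 0 < al.
Hypothesis et0 : 0 < et.
Hypothesis al_le : al <= al0.
Hypothesis ka'0 : 0 <= ka'.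
Hypothesis ka_lt : ka < ka'.

(** The first two terms force the two points together; the slope [ka'] exceeds
    the discrepancy [ka] of the two equations; [ta], [al] and [et] keep the
    maximum away from large times, from large [x] and from the boundary of the
    orthant. *)
Definition penalty (z : V * V) : R :=
  Th (z.1.2 - z.2.2) + ga * (z.1.1 - z.2.1) ^+ 2 + ka' * z.1.1
  + ta * z.1.1 ^+ 2 + ta * z.2.1 ^+ 2
  + al * \sum_k z.1.2 k 0 + al * \sum_k z.2.2 k 0
  + et * \sum_k (z.1.2 k 0)^-1 + et * \sum_k (z.2.2 k 0)^-1.

Definition Phi (z : V * V) : R := v z.1.1 z.1.2 - v' z.2.1 z.2.2 - penalty z.

Lemma jet_left t x t' x' : positive x ->
  upper_jet (fun z => penalty (z, (t', x'))) (t, x)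
    (ga * (t - t') *+ 2 + ka' + ta * t *+ 2)
    (DTh (x - x') + const_mx al + \col_k (- (et * x k 0 ^- 2))).
Proof.
move=> xp.
have [A [e [e0 q]]] := Th_quad (x - x').
have J1 : upper_jet (fun z : V => Th (z.2 - x')) (t, x) 0 (DTh (x - x')).
  apply: (@upper_jet_space _ _ (fun y => Th (y - x')) _ _ A e) => //= y hy.
  have -> : y - x' = x - x' + (y - x).
    by apply/matrixP => i j; rewrite !mxE; ring.
  apply: (le_trans (q _ _)) => [k|].
    by rewrite !mxE; exact: hy.
  rewrite (eq_bigr (fun k => DTh (x - x') k 0 * (y k 0 - x k 0))); last first.
    by move=> k _; rewrite !mxE.
  rewrite [X in _ + A * X](eq_bigr (fun k => (y k 0 - x k 0) ^+ 2)) // => k _.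
  by rewrite !mxE.
have J2 := @upper_jet_time _ _ (ga * t' ^+ 2 + ta * t' ^+ 2 +
  al * \sum_k x' k 0 + et * \sum_k (x' k 0)^-1) (ka' - ga * t' *+ 2) (ga + ta) (t, x).
have J3 := upper_jet_linear al (t, x).
have J4 := @upper_jet_inv _ _ et (t, x) (ltW et0) xp.
apply: (upper_jet_ext (upper_jetD (upper_jetD (upper_jetD J1 J2) J3) J4)).
- by move=> z; rewrite /penalty /=; ring.
- by rewrite /=; ring.
- by rewrite addr0.
Qed.

Lemma jet_right t x t' x' : positive x' ->
  upper_jet (fun z => penalty ((t, x), z)) (t', x')
    (- (ga * (t - t') *+ 2) + ta * t' *+ 2)
    (- DTh (x - x') + const_mx al + \col_k (- (et * x' k 0 ^- 2))).
Proof.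
move=> xp.
have [A [e [e0 q]]] := Th_quad (x - x').
have J1 : upper_jet (fun z : V => Th (x - z.2)) (t', x') 0 (- DTh (x - x')).
  apply: (@upper_jet_space _ _ (fun y => Th (x - y)) _ _ A e) => //= y hy.
  have -> : x - y = x - x' + (x' - y).
    by apply/matrixP => i j; rewrite !mxE; ring.
  apply: (le_trans (q _ _)) => [k|].
    by rewrite !mxE distrC; exact: hy.
  rewrite (eq_bigr (fun k => (- DTh (x - x')) k 0 * (y k 0 - x' k 0))); last first.
    by move=> k _; rewrite !mxE mulNr -mulrN opprB.
  rewrite [X in _ + A * X](eq_bigr (fun k => (y k 0 - x' k 0) ^+ 2)) // => k _.
  by rewrite !mxE -sqrrN opprB.
have J2 := @upper_jet_time _ _ (ga * t ^+ 2 + ka' * t + ta * t ^+ 2 +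
  al * \sum_k x k 0 + et * \sum_k (x k 0)^-1) (- (ga * t *+ 2)) (ga + ta) (t', x').
have J3 := upper_jet_linear al (t', x').
have J4 := @upper_jet_inv _ _ et (t', x') (ltW et0) xp.
apply: (upper_jet_ext (upper_jetD (upper_jetD (upper_jetD J1 J2) J3) J4)).
- by move=> z; rewrite /penalty /=; ring.
- by rewrite /=; ring.
- by rewrite addr0.
Qed.

(** Both equations see the gradient [DTh (x - x')], up to [al] and up to the
    derivatives of the terms in [et].  The latter decrease the argument of [F]
    and increase that of [F'], so monotonicity discards them; subtracting the
    two inequalities for the time derivative leaves [ka' <= ka]. *)
Lemma no_interior_max (t : R) (x : 'cV[R]_d) (t' : R) (x' : 'cV[R]_d) :
  0 < t -> 0 < t' -> positive x -> positive x' ->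
  (\forall z \near ((t, x) : V), Phi (z, (t', x')) <= Phi ((t, x), (t', x'))) ->
  (\forall z \near ((t', x') : V), Phi ((t, x), z) <= Phi ((t, x), (t', x'))) -> False.
Proof.
move=> t0 t'0 xp x'p m1 m2.
have J1 : upper_jet (fun z : V => v z.1 z.2) (t, x)
    (ga * (t - t') *+ 2 + ka' + ta * t *+ 2)
    (DTh (x - x') + const_mx al + \col_k (- (et * x k 0 ^- 2))).
  apply: upper_jet_max (jet_left t t' x' xp).
  by apply: filterS m1 => z; rewrite /Phi /=; lra.
have J2 : upper_jet (fun z : V => - v' z.1 z.2) (t', x')
    (- (ga * (t - t') *+ 2 - ta * t' *+ 2))
    (- (DTh (x - x') - const_mx al + \col_k (et * x' k 0 ^- 2))).
  apply: (@upper_jet_max _ _ _ (fun z => penalty ((t, x), z))).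
    by apply: filterS m2 => z; rewrite /Phi /=; lra.
  apply: (upper_jet_ext (jet_right t x t' x'p)) => //.
    by rewrite opprB addrC.
  by apply/matrixP => i j; rewrite !mxE; ring.
have h1 := v_sub (conj t0 xp : interior_domain (t, x)) J1.
have h2 := v'_super (conj t'0 x'p : interior_domain (t', x')) J2.
have h3 : F (DTh (x - x') + const_mx al + \col_k (- (et * x k 0 ^- 2))) <=
    F (DTh (x - x') + const_mx al).
  apply: F_mono => k; rewrite !mxE gerDl oppr_le0 mulr_ge0 ?ltW //.
  by rewrite invr_gt0 exprn_gt0.
have h4 : F' (DTh (x - x') - const_mx al) <=
    F' (DTh (x - x') - const_mx al + \col_k (et * x' k 0 ^- 2)).
  apply: F'_mono => k; rewrite !mxE lerDl mulr_ge0 ?ltW //.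
  by rewrite invr_gt0 exprn_gt0.
have h5 := F_close (x - x') al_gt0 al_le.
have h6 := mulr_gt0 ta0 t0.
have h7 := mulr_gt0 ta0 t'0.
have h8 := le_trans h1 (le_trans h3 h5); have h9 := le_trans h4 h2.
move: h6 h7 h8 h9; move: (F' _) (ga * _) (ta * t) (ta * t') => r1 r2 r3 r4.
move: ka_lt; move=> k1 k2 k3 k4 k5; lra.
Qed.

(* The two parabolas [C * s - ta * s ^+ 2] have maxima of sum [C ^+ 2 / (2 * ta)],
   and from [T0] on such a parabola is below minus its maximum. *)
Let M0 := C ^+ 2 / (2 * ta) + 1.
Let T0 := 2 * C / ta.

Let M0_gt0 : 0 < M0.
Proof. by rewrite /M0 ltr_wpDl // divr_ge0 ?sqr_ge0 // mulr_ge0 // ltW. Qed.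

Let PhiE (t : R) (x : 'cV[R]_d) (t' : R) (x' : 'cV[R]_d) :
  Phi ((t, x), (t', x')) = v t x - v' t' x' - Th (x - x')
   - ga * (t - t') ^+ 2 - ka' * t - ta * t ^+ 2 - ta * t' ^+ 2
   - al * (\sum_k x k 0) - al * (\sum_k x' k 0)
   - et * (\sum_k (x k 0)^-1) - et * (\sum_k (x' k 0)^-1).
Proof. by rewrite /Phi /penalty /=; ring. Qed.

Let sum_pos (x : 'cV[R]_d) : positive x ->
  (0 <= al * \sum_k x k 0) /\ (0 <= et * \sum_k (x k 0)^-1).
Proof.
move=> xp; split; apply: mulr_ge0; try exact: ltW; apply: sumr_ge0 => k _.
  by rewrite ltW.
by rewrite invr_ge0 ltW.
Qed.

(** The initial inequality and the linear growth in time bound the unpenalized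
    difference by [C * t + C * t'], independently of [x] and [x'].  Each penalty
    is therefore at most the maximum of a parabola in the times. *)
Lemma Phi_gt0_bounds (t : R) (x : 'cV[R]_d) (t' : R) (x' : 'cV[R]_d) :
  0 <= t -> 0 <= t' -> positive x -> positive x' ->
  0 < Phi ((t, x), (t', x')) ->
  [/\ t < T0, t' < T0,
      forall k, et / M0 < x k 0 < M0 / al &
      forall k, et / M0 < x' k 0 < M0 / al].
Proof.
move=> t0 t'0 xp x'p.
have C0 := C_gt0; have ta0' := ta0.
have quadC s : C * s - ta * s ^+ 2 <= C ^+ 2 / (4 * ta).
  rewrite -subr_ge0 (_ : _ - _ = ta * (s - C / (2 * ta)) ^+ 2).
    by rewrite mulr_ge0 ?sqr_ge0 // ltW.
  by field; rewrite gt_eqF.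
have C24 : 0 < C ^+ 2 / (4 * ta) by rewrite divr_gt0 ?exprn_gt0 // mulr_gt0.
have quadT s : T0 <= s -> C * s - ta * s ^+ 2 <= - (C ^+ 2 / (4 * ta)).
  rewrite /T0 ler_pdivrMr // => hs.
  have -> : C * s - ta * s ^+ 2 = - (s * (s * ta - C)) by ring.
  have s0 : 0 <= s by rewrite -(pmulr_lge0 _ ta0); lra.
  rewrite lerN2 ler_pdivrMr ?mulr_gt0 //.
  have -> : s * (s * ta - C) * (4 * ta) = 4 * (s * ta) * (s * ta - C) by ring.
  have : 0 <= (s * ta - 2 * C) * (s * ta) by rewrite mulr_ge0 //; lra.
  nra.
have M0E : M0 = C ^+ 2 / (4 * ta) + C ^+ 2 / (4 * ta) + 1.
  by rewrite /M0; field; rewrite gt_eqF.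
have D := diff_le t0 t'0 (fun k => ltW (xp k)) (fun k => ltW (x'p k)).
have P1 : 0 <= ga * (t - t') ^+ 2 by rewrite mulr_ge0 ?sqr_ge0 // ltW.
have P2 : 0 <= ka' * t by rewrite mulr_ge0.
have [S1 I1] := sum_pos xp; have [S2 I2] := sum_pos x'p.
have [Q1 Q2] := (quadC t, quadC t').
rewrite PhiE => pos.
have up (y : 'cV[R]_d) : positive y -> al * (\sum_k y k 0) < M0 ->
    et * (\sum_k (y k 0)^-1) < M0 -> forall k, et / M0 < y k 0 < M0 / al.
  move=> yp sy iy k; apply/andP; split.
    rewrite ltr_pdivrMr // mulrC -ltr_pdivrMr //.
    apply: le_lt_trans iy; rewrite ler_pM2l //.
    by apply: (@le_sum_coord _ _ (fun k => (y k 0)^-1)) => j; rewrite invr_ge0 ltW.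
  rewrite ltr_pdivlMr // mulrC; apply: le_lt_trans sy; rewrite ler_pM2l //.
  by apply: (@le_sum_coord _ _ (fun k => y k 0)) => j; rewrite ltW.
split.
- by rewrite ltNge; apply/negP => /quadT; lra.
- by rewrite ltNge; apply/negP => /quadT; lra.
- by apply: up => //; lra.
- by apply: up => //; lra.
Qed.

(** If one of the times vanishes, the difference is at most
    [C * s - ga * s ^+ 2], with [s] the other time, which is at most the maximum
    [C ^+ 2 / (4 * ga)] of this parabola. *)
Lemma Phi_large_time (t : R) (x : 'cV[R]_d) (t' : R) (x' : 'cV[R]_d) :
  0 <= t -> 0 <= t' -> positive x -> positive x' ->
  C ^+ 2 / (4 * ga) < Phi ((t, x), (t', x')) -> 0 < t /\ 0 < t'.
Proof.
move=> t0 t'0 xp x'p big.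
have quadC s : C * s - ga * s ^+ 2 <= C ^+ 2 / (4 * ga).
  rewrite -subr_ge0 (_ : _ - _ = ga * (s - C / (2 * ga)) ^+ 2).
    by rewrite mulr_ge0 ?sqr_ge0 // ltW.
  by field; rewrite gt_eqF.
have D := diff_le t0 t'0 (fun k => ltW (xp k)) (fun k => ltW (x'p k)).
have P2 : 0 <= ka' * t by rewrite mulr_ge0.
have [S1 I1] := sum_pos xp; have [S2 I2] := sum_pos x'p.
have [Q1 Q2] := (quadC t, quadC t').
have R1 : 0 <= ta * t ^+ 2 by rewrite mulr_ge0 ?sqr_ge0 // ltW.
have R2 : 0 <= ta * t' ^+ 2 by rewrite mulr_ge0 ?sqr_ge0 // ltW.
move: big; rewrite PhiE.
by split; rewrite lt_neqAle; apply/andP; split=> //; apply/eqP => tz;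
  subst; move: big D Q1 Q2; rewrite ?subr0 ?sub0r ?sqrrN ?mulr0; lra.
Qed.

Let box : set V := [set z : V | 0 <= z.1 <= T0 /\
  forall k, et / M0 <= z.2 k 0 <= M0 / al].

Lemma box_compact : compact box.
Proof.
have -> : box = `[0, T0]%classic `*`
    [set x : 'cV[R]_d | forall k, et / M0 <= x k 0 <= M0 / al].
  by apply/seteqP; split=> z [] /=; rewrite ?in_itv.
by apply: compact_setX; [exact: segment_compact|exact: cV_box_compact].
Qed.

Lemma box_closed_domain z : box z -> closed_domain z /\ positive z.2.
Proof.
move=> [/andP[t0 _] xb].
have zp : positive z.2.
  by move=> k; have /andP[+ _] := xb k; apply: lt_le_trans; rewrite divr_gt0.
by split=> //; split=> // k; rewrite ltW.
Qed.

Lemma penalty_continuous (z : V * V) : positive z.1.2 -> positive z.2.2 ->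
  {for z, continuous penalty}.
Proof.
move=> z1p z2p.
have c1 (T U : topologicalType) : continuous (@fst T U) by move=> y; exact: cvg_fst.
have c2 (T U : topologicalType) : continuous (@snd T U) by move=> y; exact: cvg_snd.
have cx1 : continuous (fun z : V * V => z.1.2).
  by move=> y; apply: (@continuous_comp _ _ _ fst snd); [exact: c1|exact: c2].
have cx2 : continuous (fun z : V * V => z.2.2).
  by move=> y; apply: (@continuous_comp _ _ _ snd snd); [exact: c2|exact: c2].
have ct1 : continuous (fun z : V * V => z.1.1).
  by move=> y; apply: (@continuous_comp _ _ _ fst fst); [exact: c1|exact: c1].
have ct2 : continuous (fun z : V * V => z.2.1).
  by move=> y; apply: (@continuous_comp _ _ _ snd fst); [exact: c2|exact: c1].
have ck1 k : continuous (fun z : V * V => z.1.2 k 0).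
  move=> y; apply: (@continuous_comp _ _ _ (fun z : V * V => z.1.2) (fun M : 'cV[R]_d => M k 0)).
    exact: cx1.
  exact: coord_continuous.
have ck2 k : continuous (fun z : V * V => z.2.2 k 0).
  move=> y; apply: (@continuous_comp _ _ _ (fun z : V * V => z.2.2) (fun M : 'cV[R]_d => M k 0)).
    exact: cx2.
  exact: coord_continuous.
have cst_mul (c : R) (f : V * V -> R) : {for z, continuous f} ->
    {for z, continuous (fun z => c * f z)}.
  by move=> cf; apply: continuousM => //; exact: cst_continuous.
have sq (f : V * V -> R) : {for z, continuous f} ->
    {for z, continuous (fun z => f z ^+ 2)}.
  by move=> cf; exact: continuousM.
rewrite /penalty.
have cD (f g : V * V -> R) : {for z, continuous f} -> {for z, continuous g} ->
    {for z, continuous (fun z => f z + g z)}.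
  by move=> cf cg; exact: continuousD.
repeat apply: (cD).
- apply: (@continuous_comp _ _ _ (fun z : V * V => z.1.2 - z.2.2) Th).
    by apply: continuousB; [exact: cx1|exact: cx2].
  exact: Th_cont.
- by apply/cst_mul/sq; apply: continuousB; [exact: ct1|exact: ct2].
- by apply/cst_mul; exact: ct1.
- by apply/cst_mul/sq; exact: ct1.
- by apply/cst_mul/sq; exact: ct2.
- by apply/cst_mul/continuous_fin_sum => k; exact: ck1.
- by apply/cst_mul/continuous_fin_sum => k; exact: ck2.
- apply/cst_mul/continuous_fin_sum => k.
  by apply: continuousV; [rewrite gt_eqF|exact: ck1].
- apply/cst_mul/continuous_fin_sum => k.
  by apply: continuousV; [rewrite gt_eqF|exact: ck2].
Qed.

Lemma Phi_continuous : {within box `*` box, continuous Phi}.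
Proof.
have c1 : {within box `*` box, continuous (fun z : V * V => v z.1.1 z.1.2)}.
  apply: (@within_continuous_comp _ _ _ _ closed_domain fst (fun z : V => v z.1 z.2)) => //.
    by move=> y; exact: cvg_fst.
  by move=> z [/box_closed_domain[]].
have c2 : {within box `*` box, continuous (fun z : V * V => v' z.2.1 z.2.2)}.
  apply: (@within_continuous_comp _ _ _ _ closed_domain snd (fun z : V => v' z.1 z.2)) => //.
    by move=> y; exact: cvg_snd.
  by move=> z [_ /box_closed_domain[]].
have c3 : {within box `*` box, continuous penalty}.
  apply/subspace_continuousP => z [/box_closed_domain[_ z1] /box_closed_domain[_ z2]].
  by apply: cvg_within_filter; exact: penalty_continuous.
apply/subspace_continuousP => z Az.
move/subspace_continuousP: c1 => /(_ z Az) c1.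
move/subspace_continuousP: c2 => /(_ z Az) c2.
move/subspace_continuousP: c3 => /(_ z Az) c3.
exact: (cvgB (cvgB c1 c2) c3).
Qed.

(** A larger value would make the maximum over a compact box positive and attained
    at positive times, in the interior of the box, which [no_interior_max] excludes. *)
Lemma Phi_diagonal_le (t : R) (x : 'cV[R]_d) : 0 <= t -> positive x ->
  Phi ((t, x), (t, x)) <= C ^+ 2 / (4 * ga).
Proof.
move=> t0 xp; rewrite leNgt; apply/negP => big.
have pos : 0 < Phi ((t, x), (t, x)).
  by apply: le_lt_trans big; rewrite divr_ge0 ?sqr_ge0 // mulr_ge0 // ltW.
have inbox (s : R) (y : 'cV[R]_d) : 0 <= s -> s < T0 ->
    (forall k, et / M0 < y k 0 < M0 / al) -> box (s, y).
  move=> s0 sT yb; split=> /=; first by rewrite s0 ltW.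
  by move=> k; have /andP[y1 y2] := yb k; rewrite !ltW.
have ref : (box `*` box) ((t, x), (t, x)).
  by have [tT _ xb _] := Phi_gt0_bounds t0 t0 xp xp pos; split; exact: inbox.
have [[[s y] [s' y']]] := compact_EVT_max (ex_intro _ _ ref)
  (compact_setX box_compact box_compact) Phi_continuous.
rewrite inE => -[/= b1 b2] max.
have [[s0 _] yp] := box_closed_domain b1.
have [[s'0 _] y'p] := box_closed_domain b2.
have big' := lt_le_trans big (max _ (mem_set ref)).
have pos' := lt_le_trans pos (max _ (mem_set ref)).
have [sT s'T yb y'b] := Phi_gt0_bounds s0 s'0 yp y'p pos'.
have [sp s'p] := Phi_large_time s0 s'0 yp y'p big'.
have near_box (r : R) (w : 'cV[R]_d) : 0 < r -> r < T0 ->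
    (forall k, et / M0 < w k 0 < M0 / al) -> \forall z \near ((r, w) : V), box z.
  move=> r0 rT wb.
  pose e := Num.min (Num.min r (T0 - r))
    (\big[Num.min/1]_k Num.min (w k 0 - et / M0) (M0 / al - w k 0)).
  have e0 : 0 < e.
    rewrite !lt_min r0 subr_gt0 rT /= lt_bigmin // => k _.
    by have /andP[w1 w2] := wb k; rewrite lt_min !subr_gt0 w1.
  have h1 := @near_time _ _ ((r, w) : V) _ e0.
  have h2 := @near_coord _ _ ((r, w) : V) _ e0.
  apply: filterS2 h1 h2 => z /= z1 z2.
  move: z1; rewrite /e !lt_min => /andP[/andP[]].
  rewrite !ltr_norml => /andP[a1 _] /andP[_ a2] _; split; first by apply/andP; split; lra.
  move=> k; have ek : e <= Num.min (w k 0 - et / M0) (M0 / al - w k 0).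
    by apply: (@le_trans _ _ (\big[Num.min/1]_k Num.min (w k 0 - et / M0) (M0 / al - w k 0)));
      [rewrite ge_min lexx orbT|exact: bigmin_le_cond].
  have := lt_le_trans (z2 k) ek.
  by rewrite lt_min !ltr_norml => /andP[/andP[c1 _] /andP[_ c2]]; apply/andP; split; lra.
apply: (no_interior_max sp s'p yp y'p).
  by apply: filterS (near_box _ _ sp sT yb) => z bz; apply: max; rewrite inE; split.
by apply: filterS (near_box _ _ s'p s'T y'b) => z bz; apply: max; rewrite inE; split.
Qed.

End penalized.

Hypothesis ka_ge0 : 0 <= ka.

(** On the diagonal the terms in [ga] vanish, so [ga] can be chosen after the
    other parameters, which are taken so small that they spend at most half of a
    supposed excess [D]. *)
Theorem jet_comparison (t : R) (x : 'cV[R]_d) : 0 <= t -> positive x ->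
  v t x - v' t x <= ka * t + Th 0.
Proof.
move=> t0 xp; rewrite leNgt; apply/negP => gt.
pose D := v t x - v' t x - ka * t - Th 0.
have D0 : 0 < D by rewrite /D; lra.
pose S := \sum_k x k 0; pose I := \sum_k (x k 0)^-1.
have S0 : 0 <= S by apply: sumr_ge0 => k _; rewrite ltW.
have I0 : 0 <= I by apply: sumr_ge0 => k _; rewrite invr_ge0 ltW.
(* At the point [(t, x)] the slope and the three pairs of penalties cost at most
   [D / 8] each; the remaining half of [D] exceeds [C ^+ 2 / (4 * ga) = D / 4]. *)
pose s := D / (8 * (t + 1)); pose ta := D / (16 * (t ^+ 2 + 1)).
pose al := Num.min al0 (D / (16 * (S + 1))); pose et := D / (16 * (I + 1)).
pose ga := C ^+ 2 / D.
have frac (c y : R) : 0 < c -> 0 <= y ->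
    0 < D / (c * (y + 1)) /\ D / (c * (y + 1)) * y <= D / c.
  move=> c0 y0; have cy : 0 < c * (y + 1) by rewrite mulr_gt0 //; lra.
  split; first by rewrite divr_gt0.
  have -> : D / (c * (y + 1)) * y = D / c * (y / (y + 1)).
    by field; rewrite !gt_eqF //; lra.
  rewrite ler_piMr ?divr_ge0 ?(ltW D0) ?(ltW c0) //.
  by rewrite ler_pdivrMr; lra.
have e8 : (0 : R) < 8 by rewrite ltr0n.
have e16 : (0 : R) < 16 by rewrite ltr0n.
have [s0 s1] := frac 8 t e8 t0.
have [ta0 ta1] := frac 16 (t ^+ 2) e16 (sqr_ge0 t).
have [al10 al1] := frac 16 S e16 S0.
have [et0 et1] := frac 16 I e16 I0.
have al_gt0 : 0 < al by rewrite lt_min al0_gt0.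
have al_le : al <= al0 by rewrite ge_min lexx.
have al2 : al * S <= D / 16.
  by apply: le_trans al1; rewrite ler_wpM2r // ge_min lexx orbT.
have ga0 : 0 < ga by rewrite divr_gt0 ?exprn_gt0.
have ka1 : 0 <= ka + s by rewrite addr_ge0 // ltW.
have ka2 : ka < ka + s by rewrite ltrDl.
have := Phi_diagonal_le ga0 ta0 al_gt0 et0 al_le ka1 ka2 t0 xp.
apply/negP; rewrite -ltNge.
have -> : C ^+ 2 / (4 * ga) = D / 4 by rewrite /ga; field; rewrite !gt_eqF.
rewrite /Phi /penalty /= !subrr expr0n /= mulr0 addr0 -/S -/I -/ta -/et.
rewrite [ltRHS](_ : _ = D - s * t - 2 * (ta * t ^+ 2) - 2 * (al * S) - 2 * (et * I)).
  have key (D' r1 r2 r3 r4 : R) : 0 < D' -> r1 <= D' / 8 -> r2 <= D' / 16 ->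
      r3 <= D' / 16 -> r4 <= D' / 16 -> D' / 4 < D' - r1 - 2 * r2 - 2 * r3 - 2 * r4.
    by move=> *; lra.
  exact: key.
by rewrite /D; ring.
Qed.

End comparison.

(** * A smooth gauge with gradients in the constraint set *)

Lemma dotp_mulmx (R : realType) d (A : 'M[R]_d) (x z : 'cV[R]_d) :
  dotp (A *m x) z = dotp x (A^T *m z).
Proof.
rewrite /dotp; under eq_bigr => i _ do rewrite mxE mulr_suml.
rewrite exchange_big; apply: eq_bigr => j _ /=.
by rewrite mxE mulr_sumr; apply: eq_bigr => i _; rewrite mxE mulrCA mulrA.
Qed.

(** The Cauchy-Schwarz inequality against the constant vector: expand the square
    and use [2 u_i u_j <= u_i^2 + u_j^2]. *)
Lemma sqr_sum_le (R : realType) d (u : 'I_d -> R) :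
  (\sum_k u k) ^+ 2 <= d%:R * \sum_k u k ^+ 2.
Proof.
have -> : d%:R * \sum_k u k ^+ 2 = \sum_i \sum_(j < d) (u i ^+ 2 + u j ^+ 2) / 2.
  have -> : \sum_i \sum_(j < d) (u i ^+ 2 + u j ^+ 2) / 2 =
    \sum_i \sum_(j < d) u i ^+ 2 / 2 + \sum_(i < d) \sum_j u j ^+ 2 / 2.
    rewrite -big_split /=; apply: eq_bigr => i _; rewrite -big_split /=.
    by apply: eq_bigr => j _; rewrite mulrDl.
  rewrite [X in X + _]exchange_big /= !sumr_const card_ord -mulr_suml.
  by rewrite -[X in _ = X + X]mulr_natl; field.
rewrite expr2 mulr_suml; apply: ler_sum => i _; rewrite mulr_sumr.
apply: ler_sum => j _; have := sqr_ge0 (u i - u j); nra.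
Qed.

Lemma mulmx_sqr_le (R : realType) d (A : 'M[R]_d) : exists2 B : R, 0 <= B &
  forall (h : 'cV[R]_d) k, (A *m h) k 0 ^+ 2 <= B * \sum_j h j 0 ^+ 2.
Proof.
exists (d%:R * \sum_k \sum_j A k j ^+ 2).
  by rewrite mulr_ge0 // sumr_ge0 // => k _; rewrite sumr_ge0 // => j _; exact: sqr_ge0.
move=> h k; rewrite mxE (le_trans (sqr_sum_le _)) // -mulrA ler_wpM2l //.
rewrite mulr_sumr; apply: ler_sum => j _.
rewrite exprMn ler_wpM2r ?sqr_ge0 //.
apply: (@le_trans _ _ (\sum_j A k j ^+ 2)).
  by apply: (@le_sum_coord _ _ (fun j => A k j ^+ 2)) => i; exact: sqr_ge0.
apply: (@le_sum_coord _ _ (fun k => \sum_j A k j ^+ 2)) => i.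
by rewrite sumr_ge0 // => l _; exact: sqr_ge0.
Qed.

Lemma mulmx_norm_le (R : realType) d (A : 'M[R]_d) : exists2 B : R, 0 <= B &
  forall (h : 'cV[R]_d) (e : R), 0 <= e -> (forall k, `|h k 0| <= e) ->
  forall k, `|(A *m h) k 0| <= B * e.
Proof.
exists (\sum_k \sum_j `|A k j|).
  by rewrite sumr_ge0 // => k _; rewrite sumr_ge0.
move=> h e e0 he k; rewrite mxE (le_trans (ler_norm_sum _ _ _)) //.
apply: (@le_trans _ _ (\sum_j `|A k j| * e)).
  by apply: ler_sum => j _; rewrite normrM ler_wpM2l.
rewrite -mulr_suml ler_wpM2r //.
by apply: (@le_sum_coord _ _ (fun k => \sum_j `|A k j|)) => i; rewrite sumr_ge0.
Qed.

(** From [1 - u <= expR (- u)], the exponential is at most [1 / (1 - u)]. *)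
Lemma expR_upper_quadratic (R : realType) (u : R) : `|u| <= 2^-1 ->
  expR u <= 1 + u + 2 * u ^+ 2.
Proof.
rewrite ler_norml => /andP[u1 u2].
have h : 1 - u <= expR (- u) by apply: expR_ge1Dx.
have p : 0 < 1 - u by lra.
rewrite expRN in h.
have -> : expR u = (expR u)^-1^-1 by rewrite invrK.
apply: (@le_trans _ _ (1 - u)^-1).
  by rewrite lef_pV2 // posrE invr_gt0 expR_gt0.
rewrite -[leLHS]mul1r ler_pdivrMr //; have := sqr_ge0 u; nra.
Qed.

(** The square root is concave, so it lies below its tangent. *)
Lemma sqrt_upper_linear (R : realType) (A u : R) : 0 < A -> 0 <= A + u ->
  Num.sqrt (A + u) <= Num.sqrt A + u / (2 * Num.sqrt A).
Proof.
move=> A0 Au; have s0 : 0 < Num.sqrt A by rewrite sqrtr_gt0.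
have sA : Num.sqrt A ^+ 2 = A by rewrite sqr_sqrtr // ltW.
set s := Num.sqrt A in s0 sA *; set y := s + _.
have y0 : 0 <= y.
  have -> : y = (s ^+ 2 + (s ^+ 2 + u)) / (2 * s) by rewrite /y; field; rewrite gt_eqF.
  by rewrite sA; apply: divr_ge0; [rewrite addr_ge0 // ltW|rewrite mulr_ge0 // ltW].
rewrite -[y]ger0_norm // -sqrtr_sqr; apply: ler_wsqrtr.
have -> : y ^+ 2 = s ^+ 2 + u + (u / (2 * s)) ^+ 2 by rewrite /y; field; rewrite gt_eqF.
by rewrite sA lerDl sqr_ge0.
Qed.

Section gauge.
Context {R : realType} {d : nat}.
Variables (G : 'M[R]_d) (a r be ep : R).
Hypothesis d_gt0 : (0 < d)%N.
Hypothesis a_gt0 : 0 < a.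
Hypothesis r_ge0 : 0 <= r.
Hypothesis be_gt0 : 0 < be.
Hypothesis ep_gt0 : 0 < ep.

Definition partition_fun (z : 'cV[R]_d) : R := \sum_k expR (be * (G^T *m z) k 0).

(** A smooth version of the support function
    [z |-> a d max_k (G^T z)_k + (r / d) sum_k |z_k|] of the set of all [G x + w]
    with [x] in the orthant, [|x|_1 = a] and [|w_k| <= r / d]. *)
Definition gauge (z : 'cV[R]_d) : R :=
  a * d%:R / be * ln (partition_fun z) +
  r / d%:R * \sum_k Num.sqrt (ep ^+ 2 + z k 0 ^+ 2).

Definition softmax (z : 'cV[R]_d) : 'cV[R]_d :=
  \col_k (expR (be * (G^T *m z) k 0) / partition_fun z).

Definition smooth_sign (z : 'cV[R]_d) : 'cV[R]_d :=
  \col_k (z k 0 / Num.sqrt (ep ^+ 2 + z k 0 ^+ 2)).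

(** The gradient of [gauge]: the gradient of a log-sum-exp is the vector of
    softmax weights. *)
Definition dgauge (z : 'cV[R]_d) : 'cV[R]_d :=
  G *m ((a * d%:R) *: softmax z) + (r / d%:R) *: smooth_sign z.

Lemma partition_gt0 z : 0 < partition_fun z.
Proof.
rewrite /partition_fun (bigD1 (Ordinal d_gt0)) //= ltr_pwDl ?expR_gt0 //.
by rewrite sumr_ge0 // => k _; rewrite expR_ge0.
Qed.

Lemma softmax_ge0 z k : 0 <= softmax z k 0.
Proof. by rewrite mxE divr_ge0 ?expR_ge0 // ltW // partition_gt0. Qed.

Lemma softmax_sum z : \sum_k softmax z k 0 = 1.
Proof.
under eq_bigr do rewrite mxE.
by rewrite -mulr_suml divff // gt_eqF // partition_gt0.
Qed.

Let S2_gt0 (z : 'cV[R]_d) k : 0 < ep ^+ 2 + z k 0 ^+ 2.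
Proof. by rewrite ltr_pwDl ?exprn_gt0 // sqr_ge0. Qed.

Lemma smooth_sign_le1 z k : `|smooth_sign z k 0| <= 1.
Proof.
rewrite mxE normrM normfV [X in _ / X]ger0_norm ?sqrtr_ge0 //.
rewrite ler_pdivrMr ?sqrtr_gt0 // mul1r -sqrtr_sqr; apply: ler_wsqrtr.
by rewrite lerDr sqr_ge0.
Qed.

(** The softmax weights are nonnegative with sum one, and the derivative of
    [sqrt (ep^2 + s^2)] is at most one in absolute value. *)
Lemma dgauge_in z : exists x w : 'cV[R]_d,
  [/\ dgauge z = G *m x + w, nonneg x, \sum_k x k 0 = a * d%:R &
      forall k, `|w k 0| <= r / d%:R].
Proof.
exists ((a * d%:R) *: softmax z), ((r / d%:R) *: smooth_sign z); split => //.
- by move=> k; rewrite mxE mulr_ge0 ?softmax_ge0 // mulr_ge0 // ltW.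
- under eq_bigr do rewrite mxE.
  by rewrite -mulr_sumr softmax_sum mulr1.
- move=> k; rewrite mxE normrM ger0_norm ?divr_ge0 //.
  by rewrite ler_piMr ?divr_ge0 // smooth_sign_le1.
Qed.

(** A weighted mean of the entries of [G^T z] is at most their maximum, hence at
    most the log-sum-exp. *)
Lemma gauge_ge (x w z : 'cV[R]_d) : nonneg x -> \sum_k x k 0 = a * d%:R ->
  (forall k, `|w k 0| <= r / d%:R) -> dotp (G *m x + w) z <= gauge z.
Proof.
move=> x0 xs wr; rewrite /gauge.
have -> : dotp (G *m x + w) z = dotp (G *m x) z + dotp w z.
  by rewrite /dotp -big_split /=; apply: eq_bigr => k _; rewrite mxE mulrDl.
rewrite dotp_mulmx; apply: lerD.
  have -> : a * d%:R / be * ln (partition_fun z) =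
      \sum_k x k 0 * (ln (partition_fun z) / be).
    by rewrite -mulr_suml xs; field; rewrite gt_eqF.
  apply: ler_sum => k _; rewrite ler_wpM2l // ler_pdivlMr // mulrC.
  rewrite -[leLHS]expRK ler_ln ?posrE ?expR_gt0 ?partition_gt0 //.
  by apply: (@le_sum_coord _ _ (fun k => expR (be * (G^T *m z) k 0))) => i; rewrite expR_ge0.
rewrite mulr_sumr; apply: ler_sum => k _.
rewrite (le_trans (ler_norm _)) // normrM ler_pM // -sqrtr_sqr.
by apply: ler_wsqrtr; rewrite lerDr sqr_ge0.
Qed.

Lemma gauge0 : gauge 0 = a * d%:R / be * ln d%:R + r * ep.
Proof.
rewrite /gauge /partition_fun; congr (_ * ln _ + _).
  under eq_bigr do rewrite mulmx0 mxE mulr0 expR0.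
  by rewrite sumr_const card_ord.
under eq_bigr do rewrite mxE expr0n addr0 sqrtr_sqr ger0_norm ?(ltW ep_gt0) //.
rewrite sumr_const card_ord -mulr_natr; field.
by rewrite pnatr_eq0 -lt0n.
Qed.

Lemma gauge_continuous : continuous gauge.
Proof.
move=> z.
have cst_mul (c : R) (f : 'cV[R]_d -> R) : {for z, continuous f} ->
    {for z, continuous (fun z => c * f z)}.
  by move=> cf; apply: continuousM => //; exact: cst_continuous.
apply: (@continuousD _ _ _ (fun z => a * d%:R / be * ln (partition_fun z))); apply/cst_mul.
  apply: (@continuous_comp _ _ _ partition_fun (@ln R)); last first.
    exact/continuous_ln/partition_gt0.
  apply: continuous_fin_sum => k.
  apply: (@continuous_comp _ _ _ (fun z : 'cV[R]_d => be * (G^T *m z) k 0) (@expR R)).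
    apply/cst_mul; rewrite (_ : (fun _ => _) = fun z : 'cV[R]_d => \sum_j G^T k j * z j 0).
      by apply: continuous_fin_sum => j; apply/cst_mul/coord_continuous.
    by apply/funext => y; rewrite mxE.
  exact: continuous_expR.
apply: continuous_fin_sum => k.
apply: (@continuous_comp _ _ _ (fun z : 'cV[R]_d => ep ^+ 2 + z k 0 ^+ 2) (@Num.sqrt R)).
  apply: continuousD; first exact: cst_continuous.
  by apply: continuousM; exact: coord_continuous.
exact: sqrt_continuous.
Qed.

(** With softmax weights [s] and [l = G^T h], the log-sum-exp increases by
    [ln (sum_k s_k exp (be l_k)) <= sum_k s_k (exp (be l_k) - 1)], and the
    exponential is below a parabola near zero; the square roots are below their
    tangents as functions of [s^2]. *)
Lemma gauge_quadratic (z0 : 'cV[R]_d) : exists A e : R, 0 < e /\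
  forall h : 'cV[R]_d, (forall k, `|h k 0| < e) ->
    gauge (z0 + h) <= gauge z0 + \sum_k dgauge z0 k 0 * h k 0 + A * \sum_k h k 0 ^+ 2.
Proof.
have [B2 B20 hB2] := mulmx_sqr_le G^T; have [B1 B10 hB1] := mulmx_norm_le G^T.
exists (a * d%:R / be * (2 * be ^+ 2 * B2) + r / d%:R * (2 * ep)^-1).
(* Below this bound on the entries of [h], the exponents [be * l_k] are at most 1/2. *)
exists (2 * be * (B1 + 1))^-1; split.
  by rewrite invr_gt0 !mulr_gt0 // ltr_wpDl.
move=> h hh.
pose y := G^T *m z0; pose l := G^T *m h; pose s := softmax z0.
have lsmall k : `|be * l k 0| <= 2^-1.
  rewrite normrM gtr0_norm //.
  have e0 : 0 <= (2 * be * (B1 + 1))^-1.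
    by rewrite invr_ge0 !mulr_ge0 ?addr_ge0 // ltW.
  have := hB1 h _ e0 (fun k => ltW (hh k)) k; rewrite -/l => lk.
  apply: (@le_trans _ _ (be * (B1 * (2 * be * (B1 + 1))^-1))).
    by rewrite ler_pM2l.
  have -> : be * (B1 * (2 * be * (B1 + 1))^-1) = 2^-1 * (B1 / (B1 + 1)).
    by field; rewrite !gt_eqF // ltr_wpDl.
  rewrite ler_piMr // ler_pdivrMr ?mul1r ?ltr_wpDl //; lra.
have part1 : ln (partition_fun (z0 + h)) <= ln (partition_fun z0) +
    be * dotp s l + 2 * be ^+ 2 * B2 * \sum_k h k 0 ^+ 2.
  have -> : partition_fun (z0 + h) =
      partition_fun z0 * \sum_k s k 0 * expR (be * l k 0).
    rewrite /partition_fun mulr_sumr; apply: eq_bigr => k _.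
    have -> : s k 0 = expR (be * y k 0) / partition_fun z0 by rewrite mxE.
    have -> : (G^T *m (z0 + h)) k 0 = y k 0 + l k 0 by rewrite mulmxDr mxE.
    rewrite mulrDr expRD.
    by rewrite -/(partition_fun z0); field; rewrite gt_eqF // partition_gt0.
  have up : \sum_k s k 0 * expR (be * l k 0) <=
      1 + (be * dotp s l + 2 * be ^+ 2 * B2 * \sum_k h k 0 ^+ 2).
    have -> : 1 + (be * dotp s l + 2 * be ^+ 2 * B2 * \sum_k h k 0 ^+ 2) =
      \sum_k s k 0 * (1 + be * l k 0 + 2 * be ^+ 2 * (B2 * \sum_k h k 0 ^+ 2)).
      set c := 2 * be ^+ 2 * (B2 * _).
      rewrite [RHS](eq_bigr (fun k => s k 0 + be * (s k 0 * l k 0) + s k 0 * c)).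
        rewrite !big_split /= -mulr_sumr -mulr_suml softmax_sum mul1r.
        by rewrite /c /dotp; ring.
      by move=> k _; ring.
    apply: ler_sum => k _; rewrite ler_wpM2l ?softmax_ge0 //.
    apply: (le_trans (expR_upper_quadratic (lsmall k))); rewrite lerD2l.
    rewrite (_ : 2 * (be * l k 0) ^+ 2 = 2 * be ^+ 2 * l k 0 ^+ 2); last by ring.
    by apply: ler_wpM2l; rewrite ?hB2 // mulr_ge0 // sqr_ge0.
  have pos : 0 < \sum_k s k 0 * expR (be * l k 0).
    rewrite lt_neqAle sumr_ge0 ?andbT; last first.
      by move=> k _; rewrite mulr_ge0 ?softmax_ge0 ?expR_ge0.
    apply/negP => /eqP /esym /psumr_eq0P => z.
    have := softmax_sum z0; rewrite big1 => [/eqP|k _]; first by rewrite eq_sym oner_eq0.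
    have := z (fun k _ => mulr_ge0 (softmax_ge0 z0 k) (expR_ge0 _)) k isT.
    by move/eqP; rewrite mulf_eq0 [X in _ || X]gt_eqF ?expR_gt0 // orbF => /eqP.
  rewrite lnM ?posrE ?partition_gt0 // -addrA lerD2l.
  have := @le_ln1Dx R (\sum_k s k 0 * expR (be * l k 0) - 1).
  rewrite subrKC => /(_ _)/le_trans; apply; lra.
have part2 k : Num.sqrt (ep ^+ 2 + (z0 + h) k 0 ^+ 2) <=
    Num.sqrt (ep ^+ 2 + z0 k 0 ^+ 2) + smooth_sign z0 k 0 * h k 0 +
    (2 * ep)^-1 * h k 0 ^+ 2.
  have s0 : 0 < Num.sqrt (ep ^+ 2 + z0 k 0 ^+ 2) by rewrite sqrtr_gt0.
  have E : ep ^+ 2 + (z0 + h) k 0 ^+ 2 =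
      ep ^+ 2 + z0 k 0 ^+ 2 + (2 * z0 k 0 * h k 0 + h k 0 ^+ 2).
    by rewrite mxE; ring.
  have := sqrt_upper_linear (S2_gt0 z0 k).
  move=> /(_ (2 * z0 k 0 * h k 0 + h k 0 ^+ 2)); rewrite -E.
  move=> /(_ (ltW (S2_gt0 _ _)))/le_trans; apply.
  rewrite -addrA lerD2l [smooth_sign _ _ _]mxE.
  set q := Num.sqrt _ in s0 *.
  have -> : (2 * z0 k 0 * h k 0 + h k 0 ^+ 2) / (2 * q) =
    z0 k 0 / q * h k 0 + (2 * q)^-1 * h k 0 ^+ 2 by field; rewrite gt_eqF.
  rewrite lerD2l ler_wpM2r ?sqr_ge0 // lef_pV2 ?posrE ?mulr_gt0 // ler_pM2l //.
  by rewrite -[leLHS]gtr0_norm // -sqrtr_sqr; apply: ler_wsqrtr; rewrite lerDl sqr_ge0.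
rewrite /gauge.
have c1 : 0 <= a * d%:R / be by rewrite divr_ge0 ?mulr_ge0 // ltW.
have c2 : 0 <= r / d%:R by rewrite divr_ge0.
apply: (le_trans (lerD (ler_wpM2l c1 part1) (ler_wpM2l c2 (ler_sum _ (fun k _ => part2 k))))).
have -> : \sum_k dgauge z0 k 0 * h k 0 =
    a * d%:R * dotp s l + r / d%:R * \sum_k smooth_sign z0 k 0 * h k 0.
  rewrite -[LHS]/(dotp (dgauge z0) h) /dgauge.
  have -> : dotp (G *m ((a * d%:R) *: softmax z0) + (r / d%:R) *: smooth_sign z0) h =
    dotp (G *m ((a * d%:R) *: softmax z0)) h + dotp ((r / d%:R) *: smooth_sign z0) h.
    by rewrite /dotp -big_split /=; apply: eq_bigr => k _; rewrite mxE mulrDl.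
  rewrite dotp_mulmx /dotp !mulr_sumr; congr (_ + _); apply: eq_bigr => k _.
    by rewrite mxE mulrA.
  by rewrite mxE mulrA.
rewrite !big_split /= -mulr_sumr.
set X1 := ln _; set X2 := dotp s l; set X3 := \sum_k h k 0 ^+ 2.
set X4 := \sum_k Num.sqrt _; set X5 := \sum_k smooth_sign z0 k 0 * _.
have -> : a * d%:R * X2 = a * d%:R / be * (be * X2) by field; rewrite gt_eqF.
lra.
Qed.

End gauge.

(** * The truncated Hamiltonian near the constraint set *)

Lemma dotpC (R : realType) d (x y : 'cV[R]_d) : dotp x y = dotp y x.
Proof. by apply: eq_bigr => k _; rewrite mulrC. Qed.

Lemma dotpDl (R : realType) d (x y z : 'cV[R]_d) :
  dotp (x + y) z = dotp x z + dotp y z.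
Proof. by rewrite /dotp -big_split; apply: eq_bigr => k _; rewrite mxE mulrDl. Qed.

Lemma dotpZl (R : realType) d (c : R) (x z : 'cV[R]_d) :
  dotp (c *: x) z = c * dotp x z.
Proof. by rewrite /dotp mulr_sumr; apply: eq_bigr => k _; rewrite mxE mulrA. Qed.

Lemma ler_dotp (R : realType) d (x y z : 'cV[R]_d) : nonneg z ->
  (forall k, x k 0 <= y k 0) -> dotp x z <= dotp y z.
Proof. by move=> z0 xy; apply: ler_sum => k _; rewrite ler_wpM2r. Qed.

Lemma norm1_nonneg (R : realType) d (x : 'cV[R]_d) : nonneg x ->
  norm1 x = d%:R^-1 * \sum_k x k 0.
Proof. by move=> x0; rewrite /norm1; congr (_ * _); apply: eq_bigr => k _; rewrite ger0_norm. Qed.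

Section hamiltonian.
Context {R : realType} (K : nat).
Local Notation d := (card_D K).
Variables (q : R -> R) (m M r : R).
Hypothesis m_gt0 : 0 < m.
Hypothesis r_ge0 : 0 <= r.
Hypothesis q_ge : forall z : R, z \in `[-1, 1] -> m <= q z.
Hypothesis q_le : forall z : R, z \in `[-1, 1] -> q z <= M.

Local Notation Q := (kmx K q).
Local Notation one := (const_mx 1 : 'cV[R]_d).

Lemma card_D_gt0 : (0 < d)%N. Proof. by rewrite expn_gt0. Qed.

Let d0 : (0 : R) < d%:R. Proof. by rewrite ltr0n card_D_gt0. Qed.

Lemma dyadic_mul (i j : 'I_d) : (dyadic i * dyadic j : R) \in `[-1, 1].
Proof.
have := @Defs.dyadic_itv R K i; have := @Defs.dyadic_itv R K j.
rewrite !in_itv /= -!ler_norml normrM => hj hi.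
by rewrite -[leRHS]mul1r ler_pM.
Qed.

Lemma kmx_tr (g : R -> R) : (kmx K g)^T = kmx K g.
Proof. by apply/matrixP => i j; rewrite !mxE [dyadic j * _]mulrC. Qed.

Lemma kmx_shift_mul (g : R -> R) b (x : 'cV[R]_d) :
  kmx K (shift_kernel g b) *m x = kmx K g *m x + const_mx (b / d%:R ^+ 2 * \sum_k x k 0).
Proof.
apply/matrixP => i j; rewrite ord1 !mxE mulr_sumr -big_split /=.
by apply: eq_bigr => k _; rewrite !mxE /shift_kernel; ring.
Qed.

Lemma kmx_ge (x : 'cV[R]_d) k : nonneg x -> m / d%:R * norm1 x <= (Q *m x) k 0.
Proof.
move=> x0; rewrite norm1_nonneg // mxE mulrA mulr_sumr; apply: ler_sum => j _.
rewrite ler_wpM2r // mxE (_ : m / _ / _ = (d%:R ^+ 2)^-1 * m); last by field; rewrite gt_eqF.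
rewrite ler_pM2l ?invr_gt0 ?exprn_gt0 //.
exact/q_ge/dyadic_mul.
Qed.

Lemma kmx_le (x : 'cV[R]_d) k : nonneg x -> (Q *m x) k 0 <= M / d%:R * norm1 x.
Proof.
move=> x0; rewrite norm1_nonneg // mxE mulrA mulr_sumr; apply: ler_sum => j _.
rewrite ler_wpM2r // mxE (_ : M / _ / _ = (d%:R ^+ 2)^-1 * M); last by field; rewrite gt_eqF.
rewrite ler_pM2l ?invr_gt0 ?exprn_gt0 //.
exact/q_le/dyadic_mul.
Qed.

Lemma norm1_ge0 (x : 'cV[R]_d) : 0 <= norm1 x.
Proof. by rewrite mulr_ge0 ?invr_ge0 // sumr_ge0. Qed.

Lemma kmx_ge0 (x : 'cV[R]_d) k : nonneg x -> 0 <= (Q *m x) k 0.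
Proof.
move=> x0; apply: le_trans (kmx_ge k x0).
by apply: mulr_ge0; [rewrite divr_ge0 // ltW|exact: norm1_ge0].
Qed.

Lemma norm1_add_const (x : 'cV[R]_d) (c : R) : nonneg x -> 0 <= c ->
  norm1 (x + c *: one) = norm1 x + c.
Proof.
move=> x0 c0; rewrite !norm1_nonneg //; last first.
  by move=> k; rewrite !mxE mulr1 addr_ge0.
under eq_bigr do rewrite !mxE mulr1.
rewrite big_split /= sumr_const card_ord -mulr_natr; field.
by rewrite gt_eqF.
Qed.

Lemma nonneg_add_const (x : 'cV[R]_d) (c : R) : nonneg x -> 0 <= c -> nonneg (x + c *: one).
Proof. by move=> x0 c0 k; rewrite !mxE mulr1 addr_ge0. Qed.

Let one_ge0 : nonneg one. Proof. by move=> k; rewrite mxE. Qed.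

Lemma norm1d_kmx_ge (x : 'cV[R]_d) : nonneg x -> m * norm1 x <= norm1d (Q *m x).
Proof.
move=> x0; pose k0 := Ordinal card_D_gt0.
apply: (@le_trans _ _ (d%:R * `|(Q *m x) k0 0|)); last exact: le_bigmax.
have h := @kmx_ge x k0 x0.
have -> : m * norm1 x = d%:R * (m / d%:R * norm1 x) by field; rewrite gt_eqF.
by rewrite ler_wpM2l // (le_trans h) // ler_norm.
Qed.

Lemma norm1d_kmx_le (x : 'cV[R]_d) : nonneg x -> norm1d (Q *m x) <= M * norm1 x.
Proof.
move=> x0; have M0 : 0 <= M.
  have z0 : (0 : R) \in `[-1, 1] by rewrite in_itv /= lerN10 ler01.
  exact: (le_trans (ltW m_gt0) (le_trans (q_ge z0) (q_le z0))).
apply: bigmax_le => [|k _]; first by rewrite mulr_ge0 ?norm1_ge0.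
rewrite (ger0_norm (kmx_ge0 k x0)).
have -> : M * norm1 x = d%:R * (M / d%:R * norm1 x) by field; rewrite gt_eqF.
by rewrite ler_wpM2l // kmx_le.
Qed.

Definition energy (x : 'cV[R]_d) : R := 2^-1 * dotp (Q *m x) x.

Lemma kmx_sym (x y : 'cV[R]_d) : dotp (Q *m x) y = dotp (Q *m y) x.
Proof. by rewrite dotp_mulmx kmx_tr dotpC. Qed.

Lemma C_fun_kmx (x : 'cV[R]_d) : nonneg x -> C_fun q (Q *m x) = energy x.
Proof.
move=> x0; rewrite /C_fun /energy; case: xgetP => [y -> [_ yx]|/(_ x)]; last first.
  by move=> /not_andP[]//.
by congr (_ * _); rewrite yx kmx_sym yx.
Qed.

(** Since the kernel matrix is symmetric,
    [Q x . x <= Q y . x = Q x . y <= Q y . y]. *)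
Lemma energy_mono (x y : 'cV[R]_d) : nonneg x -> nonneg y ->
  (forall k, (Q *m x) k 0 <= (Q *m y) k 0) -> energy x <= energy y.
Proof.
move=> x0 y0 xy; rewrite ler_pM2l ?invr_gt0 //.
apply: (@le_trans _ _ (dotp (Q *m y) x)); first exact: ler_dotp.
by rewrite kmx_sym; exact: ler_dotp.
Qed.

Lemma energy_ge0 (x : 'cV[R]_d) : nonneg x -> 0 <= energy x.
Proof.
move=> x0; rewrite mulr_ge0 // sumr_ge0 // => k _; rewrite mulr_ge0 //.
exact: kmx_ge0.
Qed.

Lemma energy_le (x : 'cV[R]_d) : nonneg x -> energy x <= 2^-1 * (M * norm1 x ^+ 2).
Proof.
move=> x0; rewrite ler_pM2l ?invr_gt0 //.
apply: (@le_trans _ _ (dotp (const_mx (M / d%:R * norm1 x)) x)).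
  by apply: ler_dotp => // k; rewrite [const_mx _ k 0]mxE kmx_le.
rewrite /dotp; under eq_bigr do rewrite mxE.
rewrite -mulr_sumr [norm1 x]norm1_nonneg // le_eqVlt.
by apply/orP; left; apply/eqP; field; rewrite gt_eqF.
Qed.

Lemma energy_add_const (x : 'cV[R]_d) (c : R) : nonneg x -> 0 <= c ->
  energy (x + c *: one) <= energy x + c * M * norm1 x + 2^-1 * c ^+ 2 * M.
Proof.
move=> x0 c0.
have -> : energy (x + c *: one) = energy x + c * dotp (Q *m one) x + c ^+ 2 * energy one.
  rewrite /energy mulmxDr -scalemxAr dotpDl dotpZl ![dotp _ (x + _)]dotpC !dotpDl !dotpZl.
  by rewrite ![dotp x _]dotpC ![dotp one _]dotpC [dotp (Q *m x) one]kmx_sym; field.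
have n1 : norm1 one = 1.
  rewrite norm1_nonneg //; under eq_bigr do rewrite mxE.
  by rewrite sumr_const card_ord mulVf // gt_eqF.
have e1 := energy_le one_ge0; rewrite n1 expr1n mulr1 in e1.
have e2 : dotp (Q *m one) x <= M * norm1 x.
  apply: (@le_trans _ _ (dotp (const_mx (M / d%:R)) x)).
    by apply: ler_dotp => // k; rewrite [const_mx _ k 0]mxE (le_trans (kmx_le _ _)) ?n1 ?mulr1.
  rewrite /dotp; under eq_bigr do rewrite mxE.
  by rewrite -mulr_sumr [norm1 x]norm1_nonneg // mulrA.
have := ler_wpM2l c0 e2; have := ler_wpM2l (sqr_ge0 c) e1.
lra.
Qed.

Lemma norm1d_ge0 (y : 'cV[R]_d) : 0 <= norm1d y.
Proof. by apply: bigmax_ge_id. Qed.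

Lemma C_tilde_ge (w : 'cV[R]_d) : - (8 * r ^+ 2 / m) <= C_tilde q m r w.
Proof.
rewrite /C_tilde; set l := _ * (_ - r).
have h : - (8 * r ^+ 2 / m) <= l.
  have -> : - (8 * r ^+ 2 / m) = 8 * r / m * (0 - r) by field; rewrite gt_eqF.
  rewrite ler_wpM2l ?divr_ge0 ?mulr_ge0 ?(ltW m_gt0) //.
  by rewrite lerD2r norm1d_ge0.
by case: ifP => // _; rewrite le_max h orbT.
Qed.

Let above (y : 'cV[R]_d) : set R :=
  [set C_tilde q m r w | w in [set w | cone q w /\ forall k, y k 0 <= w k 0]].

Let above_lb y : has_lbound (above y).
Proof. by exists (- (8 * r ^+ 2 / m)) => _ [w _ <-]; exact: C_tilde_ge. Qed.

Let above_nonempty y : above y !=set0.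
Proof.
pose c := norm1d y / m.
have c0 : 0 <= c by rewrite divr_ge0 ?norm1d_ge0 // ltW.
have z0 : nonneg (0 : 'cV[R]_d) by move=> k; rewrite mxE.
have x0 := nonneg_add_const z0 c0.
exists (C_tilde q m r (Q *m (0 + c *: one))); exists (Q *m (0 + c *: one)) => //.
split=> [|k]; first by exists (0 + c *: one).
apply: le_trans (kmx_ge k x0); rewrite norm1_add_const //.
have -> : norm1 (0 : 'cV[R]_d) = 0.
  by rewrite norm1_nonneg // big1 ?mulr0 // => j _; rewrite mxE.
have -> : m / d%:R * (0 + c) = norm1d y / d%:R by rewrite /c; field; rewrite !gt_eqF.
rewrite ler_pdivlMr // mulrC (@le_trans _ _ (d%:R * `|y k 0|)) //.
  by rewrite ler_wpM2l // ler_norm.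
exact: le_bigmax.
Qed.

Lemma H_fun_le (y x : 'cV[R]_d) : nonneg x -> (forall k, y k 0 <= (Q *m x) k 0) ->
  H_fun q m r y <= C_tilde q m r (Q *m x).
Proof.
move=> x0 yx; apply: ge_inf; first exact: above_lb.
by exists (Q *m x) => //; split => //; exists x.
Qed.

Lemma H_fun_ge (y : 'cV[R]_d) (c : R) :
  (forall x : 'cV[R]_d, nonneg x -> (forall k, y k 0 <= (Q *m x) k 0) ->
    c <= C_tilde q m r (Q *m x)) -> c <= H_fun q m r y.
Proof.
move=> h; apply: lb_le_inf; first exact: above_nonempty.
by move=> _ [_ [[x x0 <-] yx] <-]; exact: h.
Qed.

Lemma H_fun_mono (y z : 'cV[R]_d) : (forall k, y k 0 <= z k 0) ->
  H_fun q m r y <= H_fun q m r z.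
Proof.
move=> yz; apply: H_fun_ge => x x0 zx; apply: H_fun_le => // k.
exact: le_trans (zx k).
Qed.

Variable a : R.
Hypothesis a_ge0 : 0 <= a.
Hypothesis r_ge : a * M + M / m <= r.

(** On the cone itself the infimum is attained at the point, by monotonicity of
    the energy and because the penalization takes over only where it exceeds the
    energy of any vector of mass [a].  A perturbation of size [rho] is dominated by
    adding [rho / m] to all entries of the preimage, which costs [O (rho)] of
    energy as long as the preimage has bounded mass, that is, below the cutoff. *)
Lemma H_fun_near_cone (x w : 'cV[R]_d) (rho : R) :
  nonneg x -> norm1 x = a -> 0 <= rho -> rho <= 1 ->
  (forall k, `|w k 0| <= rho / d%:R) ->
  `|H_fun q m r (Q *m x + w) - energy x| <=
    (M * a / m + 2 * r * M / m ^+ 2 + M / m ^+ 2) * rho.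
Proof.
move=> x0 xa rho0 rho1 wr.
have m0 := m_gt0; have r0 := r_ge0; have a0 := a_ge0.
have mM : m <= M.
  have z0 : (0 : R) \in `[-1, 1] by rewrite in_itv /= lerN10 ler01.
  exact: (le_trans (q_ge z0) (q_le z0)).
have M0 : 0 < M by lra.
pose c := rho / m.
have c0 : 0 <= c by rewrite divr_ge0 // ltW.
have c1 : c <= m^-1 by rewrite /c -[leRHS]mul1r ler_wpM2r // invr_ge0 ltW.
have c2 : c ^+ 2 <= rho / m ^+ 2.
  rewrite /c expr_div_n ler_pM2r ?invr_gt0 ?exprn_gt0 //.
  by rewrite expr2 ler_piMl.
have shift (y : 'cV[R]_d) k : nonneg y -> (Q *m y) k 0 + rho / d%:R <= (Q *m (y + c *: one)) k 0.
  move=> y0; rewrite mulmxDr [(Q *m y + _) k 0]mxE lerD2l -scalemxAr mxE.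
  have n1 : norm1 one = 1.
    rewrite norm1_nonneg //; under eq_bigr do rewrite mxE.
    by rewrite sumr_const card_ord mulVf // gt_eqF.
  have := ler_wpM2l c0 (kmx_ge k one_ge0); rewrite n1 mulr1.
  by apply: le_trans; rewrite /c (_ : rho / m * _ = rho / d%:R) //; field; rewrite !gt_eqF.
have wk k : - (rho / d%:R) <= w k 0 <= rho / d%:R by rewrite -ler_norml.
have xc0 := nonneg_add_const x0 c0.
rewrite ler_norml; apply/andP; split.
- rewrite lerBrDl; apply: H_fun_ge => y y0 yx.
  have e1 : energy x <= energy (y + c *: one).
    apply: energy_mono => //; first exact: nonneg_add_const.
    move=> k; apply: le_trans (shift y k y0); have := yx k; have := wk k.
    by rewrite [X in X <= _ -> _]mxE => /andP[w1 _]; lra.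
  rewrite /C_tilde C_fun_kmx //; case: ifPn => [yr|].
    rewrite le_max; apply/orP; left.
    have e2 := energy_add_const y0 c0.
    have ny : norm1 y <= 2 * r / m.
      by rewrite ler_pdivlMr // mulrC (le_trans (norm1d_kmx_ge y0)).
    have e3 : c * M * norm1 y <= 2 * r * M / m ^+ 2 * rho.
      have -> : 2 * r * M / m ^+ 2 * rho = c * M * (2 * r / m) by rewrite /c; field; rewrite gt_eqF.
      by rewrite ler_wpM2l // mulr_ge0 // ltW.
    have e4 : c ^+ 2 * M <= M / m ^+ 2 * rho.
      have -> : M / m ^+ 2 * rho = rho / m ^+ 2 * M by ring.
      by rewrite ler_wpM2r // ltW.
    have e5 : 0 <= M * a / m * rho.
      by rewrite !mulr_ge0 ?invr_ge0 // ltW.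
    have e6 : 0 <= c ^+ 2 * M by rewrite mulr_ge0 ?sqr_ge0 // ltW.
    lra.
  rewrite -ltNge => yr.
  apply: (@le_trans _ _ (energy x)).
    rewrite gerDl oppr_le0 mulr_ge0 // !addr_ge0 // ?divr_ge0 ?mulr_ge0 ?exprn_ge0 // ?ltW //.
  apply: (le_trans (energy_le x0)); rewrite xa.
  apply: (@le_trans _ _ (8 * r / m * r)); last first.
    by rewrite ler_wpM2l ?divr_ge0 ?mulr_ge0 // ?ltW //; lra.
  have ar : a * M <= r by have : 0 <= M / m by [rewrite divr_ge0 // ltW]; have := r_ge; lra.
  have am : a <= r / m by rewrite ler_pdivlMr // (le_trans _ ar) // ler_wpM2l.
  have := ler_pM (mulr_ge0 a0 (ltW M0)) a0 ar am.
  have : 0 <= r * (r / m) by rewrite mulr_ge0 // divr_ge0 // ltW.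
  have -> : 8 * r / m * r = 8 * (r * (r / m)) by ring.
  lra.
- rewrite lerBlDl; apply: (@le_trans _ _ (C_tilde q m r (Q *m (x + c *: one)))).
    apply: H_fun_le => // k; apply: le_trans (shift x k x0).
    by rewrite mxE lerD2l; have /andP[] := wk k.
  have nr : norm1d (Q *m (x + c *: one)) <= r.
    apply: (le_trans (norm1d_kmx_le xc0)); rewrite norm1_add_const // xa.
    have := r_ge; have := ler_wpM2l (ltW M0) c1; lra.
  rewrite /C_tilde ifT; last by apply: (le_trans nr); lra.
  rewrite C_fun_kmx // ge_max; apply/andP; split.
    have := energy_add_const x0 c0; rewrite xa.
    have -> : c * M * a = M * a / m * rho by rewrite /c; ring.
    have e4 : c ^+ 2 * M <= M / m ^+ 2 * rho.
      have -> : M / m ^+ 2 * rho = rho / m ^+ 2 * M by ring.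
      by rewrite ler_wpM2r // ltW.
    have e5 : 0 <= 2 * r * M / m ^+ 2 * rho.
      by rewrite !mulr_ge0 ?invr_ge0 ?exprn_ge0 // ltW.
    have e6 : 0 <= c ^+ 2 * M by rewrite mulr_ge0 ?sqr_ge0 // ltW.
    lra.
  apply: (@le_trans _ _ 0).
    by rewrite mulr_ge0_le0 ?divr_ge0 ?mulr_ge0 // ?subr_le0 // ltW.
  rewrite addr_ge0 ?energy_ge0 // mulr_ge0 // !addr_ge0 // ?divr_ge0 ?mulr_ge0 ?exprn_ge0 // ?ltW //.
Qed.

End hamiltonian.

(** * Increments of Lipschitz functions from almost everywhere gradients *)

Section growth.
Context {R : realType}.
Local Notation lam := (@lebesgue_measure R).

Lemma le_lam (A B : set R) : measurable A -> measurable B -> A `<=` B ->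
  (lam A <= lam B)%E.
Proof. by move=> mA mB AB; apply: le_measure; rewrite ?inE. Qed.

(** Subtract from [F] the function [L * lam (U `&` [0, s])].  The difference does
    not increase to the right of any point: outside [U] because [F] does not, and
    inside [U] because the subtracted function has slope [L].  It rises by at
    most [L] times the distance, so the supremum of the points where it does not
    exceed its initial value is again such a point, and equals one. *)
Lemma growth_outside_open (F : R -> R) (L : R) (U : set R) (e : R) :
  (forall s s' : R, 0 <= s -> s <= s' -> s' <= 1 -> F s' - F s <= L * (s' - s)) ->
  0 <= L -> open U -> (lam U <= e%:E)%E ->
  (forall s : R, 0 <= s -> s < 1 -> ~ U s ->
    exists2 de : R, 0 < de & forall s' : R, s < s' -> s' < s + de -> F s' <= F s) ->
  F 1 <= F 0 + L * e.
Proof.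
move=> FL L0 oU Ue Fdec.
have mU : measurable U by exact: open_measurable.
pose I (s : R) : set R := U `&` `[0, s]%classic.
have mI (s : R) : measurable (I s) by exact: measurableI.
have Ifin (s : R) : (lam (I s) < +oo)%E.
  apply: (@le_lt_trans _ _ (lam U)); last by rewrite (le_lt_trans Ue) // ltry.
  by apply: le_lam => //; exact: subIsetl.
pose phi s := fine (lam (I s)).
have phiE s : (phi s)%:E = lam (I s).
  by rewrite /phi fineK // ge0_fin_numE.
have phi_mono s s' : s <= s' -> phi s <= phi s'.
  move=> ss'; rewrite -lee_fin !phiE; apply: le_lam => //.
  by apply: setIS => x /=; rewrite !in_itv /= => /andP[-> /le_trans]; exact.
have phi_grow s s' : 0 <= s -> s <= s' -> `]s, s']%classic `<=` U ->
    s' - s <= phi s' - phi s.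
  move=> s0 ss' sU; rewrite lerBrDl -lee_fin EFinD !phiE.
  have -> : (s' - s)%:E = lam `]s, s']%classic.
    rewrite lebesgue_measure_itv /= lte_fin; case: ltP => // h.
    by have -> : s' = s by [apply/eqP; rewrite eq_le h]; rewrite subrr.
  rewrite -measureU; [|exact: mI|exact: measurable_itv|].
    apply: le_lam => //; first exact: measurableU.
    move=> x [[Ux]|xs].
      rewrite /= in_itv /= => /andP[x0 xs]; split => //=.
      by rewrite in_itv /= x0 (le_trans xs).
    split; first exact: sU.
    by move: xs; rewrite /= !in_itv /= => /andP[/ltW/(le_trans s0) -> ->].
  rewrite -subset0 => x [[_ +]]; rewrite /= !in_itv /=.
  by move=> /andP[_ xs] /andP[]; rewrite ltNge xs.
pose G s := F s - L * phi s.
have Gdec s : 0 <= s -> s < 1 ->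
    exists2 de : R, 0 < de & forall s' : R, s < s' -> s' < s + de -> s' <= 1 -> G s' <= G s.
  move=> s0 s1; have [Us|nUs] := pselect (U s); last first.
    have [de de0 hde] := Fdec s s0 s1 nUs; exists de => // s' ss' s'd _.
    have := hde _ ss' s'd; have := ler_wpM2l L0 (phi_mono _ _ (ltW ss')).
    by rewrite /G; lra.
  have /nbhs_ballP[de /= de0 deU] : nbhs s U by exact: open_nbhs_nbhs.
  exists de => // s' ss' s'd s'1.
  have : `]s, s']%classic `<=` U.
    move=> x /=; rewrite in_itv /= => /andP[sx xs']; apply: deU.
    by rewrite /ball /= ltr_norml; apply/andP; split; lra.
  move=> /(phi_grow _ _ s0 (ltW ss'))/(ler_wpM2l L0).
  have := FL s s' s0 (ltW ss') s'1; rewrite /G; lra.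
pose A := [set s | [/\ 0 <= s, s <= 1 & G s <= G 0]].
have A0 : A 0 by split => //; exact: ler01.
have ubA : ubound A 1 by move=> s [].
have supA : has_sup A by split; [exists 0|exists 1].
pose c := sup A.
have c0 : 0 <= c by apply: ub_le_sup => //; exists 1.
have c1 : c <= 1 by apply: ge_sup => //; exists 0.
have Gc : G c <= G 0.
  rewrite leNgt; apply/negP => gt.
  (* If [G c] exceeded [G 0], points of [A] just below [c] would contradict the
   one-sided Lipschitz bound. *)
  pose ep := (G c - G 0) / (L + 1).
  have ep0 : 0 < ep by rewrite divr_gt0 ?subr_gt0 // ltr_wpDl.
  have [s [s0 s1 sG] cs] := sup_adherent ep0 supA.
  have sc : s <= c by apply: ub_le_sup; [exists 1|split].
  have := FL s c s0 sc c1; have := ler_wpM2l L0 (phi_mono _ _ sc).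
  have : L * (c - s) <= L * ep by rewrite ler_wpM2l //; move: cs; rewrite -/c; lra.
  have : L * ep < G c - G 0.
    rewrite /ep mulrCA -[ltRHS]mulr1 ltr_pM2l ?subr_gt0 //.
    by rewrite ltr_pdivrMr ?ltr_wpDl // mul1r ltrDl.
  move: gt sG; rewrite /G; lra.
have [cl|] := ltP c 1; last first.
  move=> cge; have cE : c = 1 by apply/eqP; rewrite eq_le c1.
  move: Gc; rewrite cE /G.
  have p0 : 0 <= phi 0 by rewrite -lee_fin phiE.
  have p1 : phi 1 <= e.
    by rewrite -lee_fin phiE (le_trans _ Ue) //; apply: le_lam => //; exact: subIsetl.
  have := mulr_ge0 L0 p0; have := ler_wpM2l L0 p1; lra.
have [de de0 hde] := Gdec c c0 cl.
(* Beyond the supremum [c < 1] the function still does not increase. *)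
pose s' := Num.min (c + de / 2) 1.
have cs' : c < s' by rewrite lt_min cl andbT ltrDl divr_gt0.
have s'd : s' < c + de by rewrite gt_min ltrD2l ltr_pdivrMr // ltr_pMr // ltr1n.
have s'1 : s' <= 1 by rewrite ge_min lexx orbT.
have : s' <= c.
  apply: ub_le_sup; first by exists 1.
  by split => //; [lra|exact: le_trans (hde _ cs' s'd s'1) Gc].
by rewrite leNgt cs'.
Qed.

Definition slab (y z lo hi t : R) : set R := [set s | lo <= y + t + s * z <= hi].

Lemma measurable_slab y z lo hi t : measurable (slab y z lo hi t).
Proof.
have -> : slab y z lo hi t = (fun s => y + t + s * z) @^-1` `[lo, hi].
  by apply/seteqP; split => s; rewrite /slab /= in_itv.
rewrite -[X in measurable X]setTI; have mf : measurable_fun setT (fun s : R => y + t + s * z).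
  by apply: measurable_funD => //; apply: measurable_funM.
by apply: mf => //; exact: measurable_itv.
Qed.

Lemma lam_itv (x y : R) : x <= y -> lam `[x, y]%classic = (y - x)%:E.
Proof.
move=> xy; rewrite lebesgue_measure_itv /= lte_fin; case: ltP => // h.
by have -> : x = y by [apply/eqP; rewrite eq_le h xy]; rewrite subrr.
Qed.

Lemma measurable_slabs (D S : set R) (y z lo hi : R) :
  measurable D -> measurable S ->
  measurable ((D `*` S) `&` (fun p : R * R => y + p.1 + p.2 * z) @^-1` `[lo, hi]).
Proof.
move=> mD mS; apply: measurableI; first exact: measurableX.
have mf : measurable_fun setT (fun p : R * R => y + p.1 + p.2 * z).
  by apply: measurable_funD; [apply: measurable_funD|apply: measurable_funM].
by rewrite -[X in measurable X]setTI; apply: mf => //; exact: measurable_itv.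
Qed.

(** For each time [s] the admissible translations form an interval of length
    [hi - lo]; integrate in the other order. *)
Lemma integral_slab_le (S : set R) (y z lo hi de : R) :
  measurable S -> lo <= hi ->
  (\int[lam]_(t in (`[0%R, de]%classic : set R)) lam (S `&` slab y z lo hi t)
    <= (hi - lo)%:E * lam S)%E.
Proof.
move=> mS lohi.
pose A : set (R * R) := (`[0%R, de]%classic `*` S) `&`
  ((fun p : R * R => y + p.1 + p.2 * z) @^-1` `[lo, hi]).
have mA : measurable A by exact: measurable_slabs.
have := @indic_fubini_tonelli _ _ _ _ R lam lam A mA.
rewrite indic_fubini_tonelli_FE // indic_fubini_tonelli_GE // => E.
apply: (@le_trans _ _ (\int[lam]_x lam (xsection A x))%E).
  rewrite integral_mkcond le_eqVlt; apply/orP; left; apply/eqP.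
  apply: eq_integral => t _; rewrite patchE; case: ifPn => [|]; rewrite ?notin_setE ?inE => tI.
    congr (lam _); apply/seteqP; split => s; rewrite /xsection /= inE /A /slab /= ?in_itv.
      by move=> [].
    by move=> [[]].
  rewrite (_ : xsection A t = set0) ?measure0 // -subset0 => s.
  by rewrite /xsection /= inE => -[[]].
rewrite [leLHS]E.
have -> : ((hi - lo)%:E * lam S = \int[lam]_(s in S) (hi - lo)%:E)%E.
  by rewrite integral_cst.
rewrite [leRHS]integral_mkcond; apply: ge0_le_integral => //.
- exact: measurable_fun_ysection.
- by apply/(measurable_restrictT _ _).1 => //; exact: measurable_cst.
- move=> s _ /=; rewrite patchE; case: ifPn; rewrite ?notin_setE ?inE => sS; last first.
    rewrite (_ : ysection A s = set0) ?measure0 // -subset0 => t.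
    by rewrite /ysection /= inE => -[[]].
  have -> : (hi - lo)%:E = lam `[lo - y - s * z, hi - y - s * z]%classic.
    by rewrite lam_itv; [congr (_%:E); ring|rewrite !lerD2r].
  apply: le_lam; [exact: measurable_ysection|exact: measurable_itv|].
  move=> t; rewrite /ysection /= inE /A /= !in_itv /= => -[_ /andP[h1 h2]].
  by apply/andP; split; lra.
Qed.

End growth.

Section good_shift.
Context {R : realType}.
Local Notation lam := (@lebesgue_measure R).

Lemma measurable_lam_slab (S : set R) (y z lo hi : R) (D : set R) : measurable S ->
  measurable D ->
  measurable_fun D (fun t => lam (S `&` slab y z lo hi t)).
Proof.
move=> mS mD.
pose A : set (R * R) := (setT `*` S) `&`
  ((fun p : R * R => y + p.1 + p.2 * z) @^-1` `[lo, hi]).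
have mA : measurable A by exact: measurable_slabs.
apply: measurable_funTS; rewrite (_ : (fun _ => _) = lam \o xsection A).
  exact: measurable_fun_xsection.
apply/funext => t /=; congr (lam _); apply/seteqP; split => s;
  rewrite /xsection /= inE /A /slab /= ?in_itv.
  by move=> [].
by move=> [[]].
Qed.

(** The mean over all translations in [[0, de]] is at most [e / de], so some
    translation does not exceed twice this value. *)
Lemma good_shift_one (S : nat -> set R) (c y z lo hi : nat -> R) (de e : R) :
  0 < de -> 0 < e -> (forall n, measurable (S n)) ->
  (forall n, 0 <= c n) -> (forall n, lo n <= hi n) ->
  (\sum_(0 <= n <oo) ((c n * (hi n - lo n))%:E * lam (S n)) <= e%:E)%E ->
  exists2 t, 0 <= t <= de &
    (\sum_(0 <= n <oo) ((c n)%:E * lam (S n `&` slab (y n) (z n) (lo n) (hi n) t))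
      <= (e * (2 / de))%:E)%E.
Proof.
move=> de0 e0 mS c0 lohi bound; apply/not_exists2P => nex.
pose D : set R := `[0%R, de]%classic.
have mD : measurable D by exact: measurable_itv.
pose f n t := ((c n)%:E * lam (S n `&` slab (y n) (z n) (lo n) (hi n) t))%E.
have f0 n t : (0 <= f n t)%E by rewrite mule_ge0 ?lee_fin.
have mf n : measurable_fun D (f n).
  by apply: measurable_funeM; exact: measurable_lam_slab.
have : ((e * (2 / de))%:E * lam D <= \int[lam]_(t in D) \sum_(0 <= n <oo) f n t)%E.
  rewrite -integral_cst //; apply: ge0_le_integral => //.
  - by move=> t _; rewrite lee_fin mulr_ge0 ?divr_ge0 // ltW.
  - by apply: ge0_emeasurable_sum => *; [exact: f0|exact: mf].
  - move=> t Dt; have [/negP|/negP] := nex t.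
      by move: Dt; rewrite /D /= in_itv /= => ->.
    by rewrite -ltNge => /ltW.
rewrite lam_itv ?(ltW de0) // subr0 -EFinM.
rewrite integral_nneseries // => /le_trans h.
have : ((e * (2 / de) * de)%:E <= e%:E)%E.
  apply: h; apply: le_trans bound; apply: lee_nneseries => [n _ _|n _].
    exact: integral_ge0.
  rewrite ge0_integralZl //; last 2 first.
  - exact: measurable_lam_slab.
  - by rewrite lee_fin.
  by rewrite EFinM -muleA lee_wpmul2l ?lee_fin // integral_slab_le.
rewrite lee_fin (_ : e * (2 / de) * de = 2 * e); first by lra.
by field; rewrite gt_eqF.
Qed.

Definition box_trace d (x h z lo hi : 'I_d -> R) (ks : seq 'I_d) : set R :=
  [set s | forall k, k \in ks -> lo k <= x k + h k + s * z k <= hi k].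

(** Averaging over one coordinate of the translation replaces the side of each box
    in this direction by the constraint that the segment satisfies it.  Repeating
    this for all coordinates turns the total volume of the boxes into the total
    time spent in them. *)
Lemma good_shift_seq (d : nat) (x z : 'I_d -> R) (lo hi : nat -> 'I_d -> R)
    (de : R) (ks : seq 'I_d) :
  0 < de -> (forall n k, lo n k <= hi n k) -> uniq ks ->
  forall (S : nat -> set R) (e : R), 0 < e -> (forall n, measurable (S n)) ->
  (\sum_(0 <= n <oo) ((\prod_(k <- ks) (hi n k - lo n k))%:E * lam (S n)) <= e%:E)%E ->
  exists2 h : 'I_d -> R, forall k, 0 <= h k <= de &
    (\sum_(0 <= n <oo) lam (S n `&` box_trace x h z (lo n) (hi n) ks)
      <= (e * (2 / de) ^+ size ks)%:E)%E.
Proof.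
move=> de0 lohi; elim: ks => [_ S e e0 mS|k ks IH /= /andP[kks uks] S e e0 mS] bound.
  exists (fun=> 0) => [k|]; first by rewrite lexx ltW.
  rewrite expr0 mulr1; apply: le_trans bound; rewrite le_eqVlt; apply/orP; left; apply/eqP.
  apply: eq_eseriesr => n _; rewrite big_nil mul1e; congr (lam _).
  by apply/seteqP; split => [s []|s] //.
have prod0 n : 0 <= \prod_(k <- ks) (hi n k - lo n k).
  by apply: prodr_ge0 => i _; rewrite subr_ge0.
have [|t t0 ht] := @good_shift_one S (fun n => \prod_(k <- ks) (hi n k - lo n k))
  (fun=> x k) (fun=> z k) (lo ^~ k) (hi ^~ k) de e de0 e0 mS prod0 (lohi^~ k).
  apply: le_trans bound; rewrite le_eqVlt; apply/orP; left; apply/eqP.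
  by apply: eq_eseriesr => n _; rewrite big_cons mulrC.
have e'0 : 0 < e * (2 / de) by rewrite mulr_gt0 ?divr_gt0.
have [||h h0 hh] := IH uks (fun n => S n `&` slab (x k) (z k) (lo n k) (hi n k) t) _ e'0.
- by move=> n; apply: measurableI => //; exact: measurable_slab.
- exact: ht.
exists (fun i => if i == k then t else h i) => [i|]; first by case: ifP.
rewrite exprS mulrA; apply: le_trans hh; rewrite le_eqVlt; apply/orP; left.
apply/eqP; apply: eq_eseriesr => n _; congr (lam _).
apply/seteqP; split => [s [Ss hs]|s [[Ss sk] hs]].
  split; first split => //.
    by have := hs k (mem_head _ _); rewrite eqxx.
  move=> i iks; have := hs i; rewrite in_cons iks orbT => /(_ isT).
  by case: eqP iks kks => // -> ->.
split => // i; rewrite in_cons; case: eqP => [-> _|_ /=]; first exact: sk.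
exact: hs.
Qed.

End good_shift.

Lemma derive_lt_right (R : realType) (V : normedModType R) (f : V -> R) (x v : V) (c : R) :
  differentiable f x -> 'D_v f x < c ->
  exists2 de : R, 0 < de & forall t : R, 0 < t -> t < de -> f (x + t *: v) - f x <= c * t.
Proof.
move=> df Dc.
have dv : derivable f x v by exact: diff_derivable.
have cv : (fun h : R => h^-1 *: ((f \o shift x) (h *: v) - f x)) @ 0^' --> 'D_v f x by exact: dv.
have : \forall h \near 0^', h^-1 *: ((f \o shift x) (h *: v) - f x) < c.
  have nb : nbhs ('D_v f x) [set y | y < c] by exact: lt_nbhsl.
  exact: cv nb.
rewrite near_withinE => /nbhs_ballP[de /= de0 hde]; exists de => // t t0 td.
have tb : ball (0 : R) de t by rewrite /ball /= sub0r normrN gtr0_norm.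
have tn : t != 0 by rewrite gt_eqF.
have h : t^-1 * (f (t *: v + x) - f x) < c by exact: hde t tb tn.
by move: h; rewrite mulrC ltr_pdivrMr // (addrC _ x) => /ltW.
Qed.

Section segment.
Context {R : realType} {d : nat}.
Local Notation lam := (@lebesgue_measure R).

Lemma measurable_box_trace (x h z lo hi : 'I_d -> R) (ks : seq 'I_d) :
  measurable (box_trace x h z lo hi ks).
Proof.
elim: ks => [|k ks IH].
  rewrite (_ : box_trace _ _ _ _ _ _ = setT); first exact: measurableT.
  by apply/seteqP; split.
rewrite (_ : box_trace _ _ _ _ _ _ =
    slab (x k) (z k) (lo k) (hi k) (h k) `&` box_trace x h z lo hi ks).
  by apply: measurableI => //; exact: measurable_slab.
apply/seteqP; split => [s hs|s [sk hs] i].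
  split; first exact: hs (mem_head _ _).
  by move=> i iks; apply: hs; rewrite in_cons iks orbT.
by rewrite in_cons => /orP[/eqP ->|/hs].
Qed.

(** Along a translated segment that spends little time in the exceptional set, the
    increment is at most [c] up to a small error, and a small translation changes
    it little. *)
Lemma increment_le_of_gradient (psi : 'cV[R]_d -> R) (L c : R) (x x' : 'cV[R]_d)
    (N : set 'cV[R]_d) :
  nonneg x -> nonneg x' -> 0 <= L ->
  (forall y y' : 'cV[R]_d, nonneg y -> nonneg y' ->
    `|psi y - psi y'| <= L * \sum_k `|y k 0 - y' k 0|) ->
  lebesgue_null N ->
  (forall y : 'cV[R]_d, nonneg y -> ~ N y ->
    differentiable psi y /\ 'D_(x' - x) psi y <= c) ->
  psi x' - psi x <= c.
Proof.
move=> x0 x'0 L0 psiL nullN gradN; apply/ler_addgt0Pl => th' th'0.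
pose th := th' / 4; have th0 : 0 < th by rewrite divr_gt0.
pose z := x' - x; pose Z := \sum_k `|z k 0|.
have Z0 : 0 <= Z by apply: sumr_ge0.
pose de := th / (L * d%:R + 1).
have Ld : 0 < L * d%:R + 1 by rewrite ltr_wpDl // mulr_ge0.
have de0 : 0 < de by rewrite divr_gt0.
have Lde : L * (d%:R * de) <= th.
  rewrite /de (_ : L * (d%:R * (th / (L * d%:R + 1))) = th * (L * d%:R / (L * d%:R + 1))).
    by rewrite ler_piMr ?(ltW th0) // ler_pdivrMr // mul1r lerDl.
  by field; rewrite gt_eqF.
pose L' := L * Z + `|c + th| + 1.
have L'0 : 0 < L' by rewrite ltr_wpDl // addr_ge0 // mulr_ge0.
(* This volume compensates the factor lost in the choice of the translation, so
   that the time in the boxes is at most [th / (2 * L')]. *)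
pose e := th / (2 * L') * (de / 2) ^+ d.
have e0 : 0 < e by rewrite mulr_gt0 ?exprn_gt0 ?divr_gt0 ?mulr_gt0.
have eE : e * (2 / de) ^+ d = th / (2 * L').
  rewrite /e -mulrA -exprMn (_ : de / 2 * (2 / de) = 1) ?expr1n ?mulr1 //.
  by field; rewrite gt_eqF.
have [lo [hi [lohi cov vol]]] := nullN e e0.
pose I01 : set R := `[0%R, 1%R]%classic.
have mI : measurable I01 by exact: measurable_itv.
have lamI : lam I01 = 1%E by rewrite lam_itv // subr0.
have [|h hde hh] := @good_shift_seq R d (fun k => x k 0) (fun k => z k 0)
  (fun n k => lo n k 0) (fun n k => hi n k 0) de (enum 'I_d) de0 lohi (enum_uniq _)
  (fun=> I01) e e0 (fun=> mI).
  apply: le_trans vol; rewrite le_eqVlt; apply/orP; left; apply/eqP.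
  by apply: eq_eseriesr => n _; rewrite lamI mule1 big_enum.
pose T n := I01 `&` box_trace (fun k => x k 0) h (fun k => z k 0)
  (fun k => lo n k 0) (fun k => hi n k 0) (enum 'I_d).
have mT n : measurable (T n) by apply: measurableI => //; exact: measurable_box_trace.
pose A := \bigcup_n T n.
have mA : measurable A by apply: bigcup_measurable => n _; exact: mT.
have lamA : (lam A <= (th / (2 * L'))%:E)%E.
  rewrite -eE -[X in (2 / de) ^+ X](size_enum_ord d).
  by apply: le_trans hh; exact: measure_sigma_subadditive.
have th2 : 0 < th / (2 * L') by rewrite divr_gt0 // mulr_gt0.
have [|U [oU AU UA]] := lebesgue_regularity_outer mA _ th2.
  by rewrite (le_lt_trans lamA) // ltry.
have mU : measurable U by exact: open_measurable.
have lamU : (lam U <= (th / L')%:E)%E.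
  have -> : th / L' = th / (2 * L') + th / (2 * L') by field; rewrite gt_eqF.
  rewrite (_ : U = A `|` (U `\` A)); last by rewrite setDUK.
  apply: (le_trans (measureU2 _ _ _)) => //; first exact: measurableD.
  by rewrite EFinD leeD // ltW.
pose hv : 'cV[R]_d := \col_k h k.
pose ga s : 'cV[R]_d := x + hv + s *: z.
have gaE s k : ga s k 0 = x k 0 + h k + s * z k 0 by rewrite !mxE.
have ga0 s : 0 <= s -> s <= 1 -> nonneg (ga s).
  move=> s0 s1 k; rewrite gaE !mxE.
  have /andP[hk _] := hde k; have := mulr_ge0 s0 (x'0 k).
  have : 0 <= (1 - s) * x k 0 by rewrite mulr_ge0 // subr_ge0.
  by rewrite mulrBl mul1r mulrBr; lra.
pose F s := psi (ga s) - (c + th) * s.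
have F10 : F 1 <= F 0 + L' * (th / L').
  apply: (@growth_outside_open R F L' U _) => //; last 1 first.
  - move=> s s0 s1 nUs.
    have sI : I01 s by rewrite /I01 /= in_itv /= s0 ltW.
    have nN : ~ N (ga s).
      move=> /cov[n _ /= hn]; apply/nUs/AU; exists n => //; split => // k _.
      by rewrite -gaE; exact: hn.
    have [dpsi Dc] := gradN _ (ga0 s s0 (ltW s1)) nN.
    have [|r r0 hr] := @derive_lt_right _ _ psi (ga s) z (c + th) dpsi.
      by apply: (le_lt_trans Dc); rewrite ltrDl.
    exists r => // s' ss' s'r; have := hr (s' - s).
    rewrite subr_gt0 ltrBlDl => /(_ ss' s'r).
    have -> : ga s + (s' - s) *: z = ga s' by rewrite /ga -addrA -scalerDl subrKC.
    by rewrite /F; lra.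
  - move=> s s' s0 ss' s'1.
    have := psiL (ga s') (ga s) (ga0 _ (le_trans s0 ss') s'1) (ga0 _ s0 (le_trans ss' s'1)).
    have -> : \sum_k `|ga s' k 0 - ga s k 0| = (s' - s) * Z.
      rewrite /Z mulr_sumr; apply: eq_bigr => k _; rewrite !gaE.
      rewrite (_ : _ - _ = (s' - s) * z k 0); last by ring.
      by rewrite normrM ger0_norm // subr_ge0.
    move=> /(le_trans (ler_norm _)) h1.
    have h2 : - (c + th) * (s' - s) <= `|c + th| * (s' - s).
      by rewrite ler_wpM2r ?subr_ge0 // -normrN ler_norm.
    rewrite /F /L'; have ss0 : 0 <= s' - s by rewrite subr_ge0.
    have -> : psi (ga s') - (c + th) * s' - (psi (ga s) - (c + th) * s) =
      (psi (ga s') - psi (ga s)) + - (c + th) * (s' - s) by ring.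
    have -> : (L * Z + `|c + th| + 1) * (s' - s) =
      L * ((s' - s) * Z) + `|c + th| * (s' - s) + (s' - s) by ring.
    lra.
  - exact: ltW.
have near_end s : 0 <= s -> s <= 1 -> `|psi (ga s) - psi (x + s *: z)| <= th.
  move=> s0 s1.
  have xs : nonneg (x + s *: z).
    move=> k; rewrite !mxE; have := mulr_ge0 s0 (x'0 k).
    have : 0 <= (1 - s) * x k 0 by rewrite mulr_ge0 // subr_ge0.
    by rewrite mulrBl mul1r mulrBr; lra.
  apply: (le_trans (psiL _ _ (ga0 _ s0 s1) xs)); apply: le_trans Lde.
  rewrite ler_wpM2l // -[d in d%:R]card_ord -sum1_card natr_sum mulr_suml.
  apply: ler_sum => k _; rewrite mul1r !mxE.
  have /andP[h1 h2] := hde k.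
  rewrite (_ : _ - _ = h k); last by ring.
  by rewrite ger0_norm.
have n1 := near_end 1 ler01 (lexx _); have n0 := near_end 0 (lexx _) ler01.
move: n1 n0; rewrite scale1r scale0r addr0 /z subrKC -/z => n1 n0.
move: F10; rewrite /F mulr1 mulr0 subr0 mulrCA divff ?gt_eqF // mulr1.
move: n1 n0; rewrite !ler_norml => /andP[n1 n1'] /andP[n0 n0'].
by rewrite /th in n1 n1' n0 n0' *; lra.
Qed.

End segment.

(** * Discretized measures and total variation *)

Section masses.
Context {R : realType} (K : nat).
Local Notation d := (card_D K).

Lemma measurable_I11 : measurable (@I11 R).
Proof. exact: measurable_itv. Qed.

Lemma atomic_measure_nonneg (x : 'cV[R]_d) (A : set R) : nonneg x ->
  fine (mu_of x A) = d%:R^-1 * \sum_k x k 0 * \1_A (dyadic k).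
Proof.
move=> x0; rewrite [X in fine X](@atomic_measureE R K x A).
under eq_bigr => k _ do rewrite diracE -indicE -EFinM.
by rewrite sumEFin -EFinM /=; congr (_ * _); apply: eq_bigr => k _; rewrite max_r.
Qed.

Lemma mass_mu_of (x : 'cV[R]_d) : nonneg x -> mass (mu_of x) = d%:R^-1 * \sum_k x k 0.
Proof.
move=> x0; rewrite /mass atomic_measure_nonneg //; congr (_ * _).
apply: eq_bigr => k _; rewrite indicE mem_set ?mulr1 //.
exact: Defs.dyadic_itv.
Qed.

Lemma x_of_nonneg (mu : Mplus R) : nonneg (x_of K mu).
Proof. by move=> k; rewrite mxE mulr_ge0 ?fine_ge0. Qed.

Let knot (j : nat) : R := j%:R / 2 ^+ K - 1.

Let knot_mono i j : (i <= j)%N -> knot i <= knot j.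
Proof.
by move=> ij; rewrite /knot lerD2r ler_pM2r ?invr_gt0 ?exprn_gt0 // ler_nat.
Qed.

Let knotS j : knot j.+1 = knot j + 2 ^- K.
Proof. by rewrite /knot -natr1; ring. Qed.

(** The cells are consecutive intervals; their masses are added from left to right. *)
Lemma sum_x_of (mu : Mplus R) : d%:R^-1 * \sum_k x_of K mu k 0 = mass mu.
Proof.
under eq_bigr do rewrite mxE.
rewrite -mulr_sumr mulrA mulVf ?mul1r; last by rewrite pnatr_eq0 -lt0n expn_gt0.
have fin (A : set R) : measurable A -> mu A \is a fin_num by exact: fin_num_measure.
have part (j : nat) : (j < d)%N ->
    mu `[-1, knot j[%classic = (\sum_(k < j) mu `[knot k, knot k.+1[%classic)%E.
  elim: j => [_|j IH jd].
    rewrite big_ord0 /knot mul0r sub0r (_ : `[_, _[%classic = set0) ?measure0 //.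
    by rewrite -subset0 => s /=; rewrite in_itv /= => /andP[h1]; rewrite ltNge h1.
  rewrite big_ord_recr /= -IH; last exact: ltnW.
  rewrite -measureU //; last first.
    rewrite -subset0 => s [] /=; rewrite !in_itv /= => /andP[_ h1] /andP[h2 _].
    by move: h1; rewrite ltNge h2.
  congr (mu _); apply/seteqP; split => s /=; rewrite !in_itv /=.
    move=> /andP[h1 h2]; have [h3|h3] := ltP s (knot j).
      by left; rewrite h1.
    by right; rewrite h2 andbT.
  case=> /andP[h1 h2].
    by rewrite h1 (lt_le_trans h2) // knot_mono.
  rewrite h2 andbT (le_trans _ h1) //.
  by rewrite (_ : -1 = knot 0) ?knot_mono // /knot mul0r sub0r.
pose cellN (j : nat) : set R :=
  if j.+1 == d then `[knot j, 1]%classic else `[knot j, knot j.+1[%classic.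
have cellE (k : 'I_d) : cell k = cellN k by rewrite /cell /cellN knotS.
have d_gt0 : (0 < d)%N by rewrite expn_gt0.
have finmu (k : 'I_d) : mu (cell k) \is a fin_num.
  by apply: fin; rewrite cellE /cellN; case: ifP => _; exact: measurable_itv.
rewrite /mass sum_fine //; congr fine.
under eq_bigr do rewrite cellE.
rewrite -(big_mkord xpredT (fun j => mu (cellN j))) -(prednK d_gt0) big_nat_recr //=.
rewrite big_mkord {2}/cellN prednK // eqxx.
have -> : (\sum_(k < d.-1) mu (cellN k))%E = mu `[-1, knot d.-1[%classic.
  rewrite part ?prednK //; apply: eq_bigr => k _; rewrite /cellN ifF //.
  by apply/negbTE; rewrite neq_ltn -[X in (_ < X)%N](prednK d_gt0) ltnS ltn_ord.
have k1 : knot d.-1 <= 1.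
  rewrite /knot lerBlDr ler_pdivrMr ?exprn_gt0 // -(natrD R 1 1) -natrX -natrM ler_nat.
  by rewrite addn1 -expnS leq_pred.
have k0 : -1 <= knot d.-1.
  by rewrite (_ : -1 = knot 0) ?knot_mono // /knot mul0r sub0r.
rewrite -measureU //; last first.
  rewrite -subset0 => s [] /=; rewrite !in_itv /= => /andP[_ h1] /andP[h2 _].
  by move: h1; rewrite ltNge h2.
congr (mu _); apply/seteqP; split => s /=; rewrite /I11 /= !in_itv /=.
  by case=> /andP[h1 h2]; [rewrite h1 (le_trans (ltW h2))|rewrite (le_trans k0)].
move=> /andP[h1 h2]; have [h3|h3] := ltP s (knot d.-1).
  by left; rewrite h1.
by right; rewrite h2.
Qed.

End masses.

Section total_variation.
Context {R : realType}.
Implicit Types mu nu : Mplus R.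

Lemma TV_has_ubound mu nu : has_ubound [set `|fine (mu A) - fine (nu A)| | A in
    [set A : set R | measurable A /\ A `<=` I11]].
Proof.
have bnd (xi : Mplus R) (A : set R) : measurable A -> A `<=` I11 ->
    0 <= fine (xi A) <= fine (xi I11).
  move=> mA AI; rewrite fine_ge0 //= fine_le ?fin_num_measure //.
  - exact: measurable_I11.
  - by apply: le_measure; rewrite ?inE //; exact: measurable_I11.
exists (fine (mu I11) + fine (nu I11)) => _ [A [mA AI] <-].
have /andP[a1 a2] := bnd mu A mA AI; have /andP[b1 b2] := bnd nu A mA AI.
by rewrite ler_norml; apply/andP; split; lra.
Qed.

Lemma TV_ge mu nu (A : set R) : measurable A -> A `<=` I11 ->
  `|fine (mu A) - fine (nu A)| <= TV mu nu.
Proof. by move=> mA AI; apply: ub_le_sup; [exact: TV_has_ubound|exists A]. Qed.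

(** Both measures are carried by the same points, so a set contributes at most the
    sum of all differences of weights. *)
Lemma TV_mu_of K (x y : 'cV[R]_(card_D K)) : nonneg x -> nonneg y ->
  TV (mu_of x) (mu_of y) <= (card_D K)%:R^-1 * \sum_k `|x k 0 - y k 0|.
Proof.
move=> x0 y0; apply: ge_sup.
  exists `|fine (mu_of x set0) - fine (mu_of y set0)|; exists set0 => //.
  by split; [exact: measurable0|exact: sub0set].
move=> _ [A _ <-]; rewrite !atomic_measure_nonneg // -mulrBr -sumrB normrM.
rewrite ger0_norm ?invr_ge0 // ler_wpM2l ?invr_ge0 //.
apply: (le_trans (ler_norm_sum _ _ _)); apply: ler_sum => k _.
rewrite -mulrBl normrM ler_piMr // indicE; case: (_ \in _); rewrite ?normr1 ?normr0 //.
Qed.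

Lemma mass_TV mu nu : `|mass mu - mass nu| <= TV mu nu.
Proof. exact: TV_ge (@measurable_I11 R) (@subset_refl _ _). Qed.

(** The mass is one of the evaluations in the supremum that defines the total
    variation, hence Lipschitz with constant one. *)
Lemma lipTV_shift_init (psi : Mplus R -> R) a b : H2 psi ->
  exists L : R, 0 <= L /\
    (forall mu nu, `|psi mu - psi nu| <= L * TV mu nu) /\
    (lipTV (shift_init psi a b) <= (L + `|a * b|)%:E)%E.
Proof.
move=> [_ psiL]; exists `|fine (lipTV psi)|; split; first exact: normr_ge0.
have TV0 mu nu : 0 <= TV mu nu by apply: le_trans (mass_TV mu nu).
have psiL' mu nu : `|psi mu - psi nu| <= `|fine (lipTV psi)| * TV mu nu.
  by apply: (le_trans (psiL mu nu)); rewrite ler_wpM2r // ler_norm.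
split => //; apply: ereal_inf_lbound; exists (`|fine (lipTV psi)| + `|a * b|) => //.
split => [|mu nu]; first by rewrite addr_ge0.
rewrite /shift_init (_ : _ - _ = (psi mu - psi nu) + a * b * (mass mu - mass nu)); last by ring.
rewrite (le_trans (ler_normD _ _)) // mulrDl lerD // normrM ler_wpM2l //.
exact: mass_TV.
Qed.

Lemma C1_bounded (g : R -> R) : C1_itv g ->
  exists2 M : R, 0 <= M & forall z, z \in `[-1, 1] -> `|g z| <= M.
Proof.
move=> [g' _ dg].
have cg : {within @I11 R, continuous g}.
  apply/subspace_continuousP => x Ix.
  have y_x : (fun y : R => y - x) @ within I11 x^' --> (0 : R).
    have c0 : (fun y : R => y - x) @ nbhs x --> (0 : R).
      by rewrite -[X in _ --> X](subrr x); apply: cvgB; [exact: cvg_id|exact: cvg_cst].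
    move=> S S0; have h : nbhs x ((fun y => y - x) @^-1` S) by exact: c0 S0.
    by apply: (@filterS _ (nbhs x) _ _ _ _ h) => y Sy _ _.
  have FF : Filter (within (@I11 R) x^') by exact: within_filter.
  have := cvgM (dg x Ix) y_x; rewrite mulr0 => /(_ FF) h.
  apply/cvgrPdist_lt => e e0; have {}h := (cvgrPdist_lt _ _).1 h e e0; move: (h FF).
  rewrite !near_withinE => {}h.
  apply: (@filterS _ (nbhs x) _ _ _ _ h) => y hy Iy.
  have [->|yx] := eqVneq y x; first by rewrite subrr normr0.
  have : `|0 - (g y - g x) / (y - x) * (y - x)| < e by exact: hy.
  by rewrite mulfVK ?subr_eq0 // sub0r opprB.
have I0 : @I11 R !=set0 by exists 0; rewrite /I11 /= in_itv /= lerN10 ler01.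
have [c1 _ h1] := compact_EVT_max I0 (@segment_compact R (-1) 1) cg.
have [c2 _ h2] := compact_EVT_min I0 (@segment_compact R (-1) 1) cg.
exists (`|g c1| + `|g c2|) => [|z Iz]; first by rewrite addr_ge0.
have {}h1 := h1 z (mem_set Iz); have {}h2 := h2 z (mem_set Iz).
have := ler_norm (g c1); have := ler_norm (- g c2); rewrite normrN.
have := normr_ge0 (g c1); have := normr_ge0 (g c2).
by rewrite ler_norml => *; apply/andP; split; lra.
Qed.

End total_variation.

(** * The equation with the linear part removed *)

Lemma lip1_bound (R : realType) d (h : 'cV[R]_d -> R) : (0 < d)%N ->
  (lip1 h < +oo)%E -> exists2 M : R, 0 <= M &
  forall x y : 'cV[R]_d, nonneg x -> nonneg y -> `|h x - h y| <= M * norm1 (x - y).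
Proof.
move=> d0 hM; have [r rP] : exists r : R, (lip1 h <= r%:E)%E.
  by case: (lip1 h) hM => [r _|//|_]; [exists r|exists 0; exact: leNye].
exists `|r| => // x y x0 y0; have [->|xy] := eqVneq x y.
  by rewrite subrr normr0 mulr_ge0 // mulr_ge0 ?invr_ge0 // sumr_ge0.
have n0 : 0 < norm1 (x - y).
  rewrite mulr_gt0 ?invr_gt0 ?ltr0n // lt_neqAle sumr_ge0 // andbT eq_sym.
  apply: contraNneq xy => /psumr_eq0P s0; apply/eqP/matrixP => i j; rewrite ord1.
  have /normr0_eq0 := s0 (fun k _ => normr_ge0 _) i isT.
  by rewrite !mxE => /subr0_eq.
rewrite -ler_pdivrMr // (@le_trans _ _ r) ?ler_norm // -lee_fin.
apply: le_trans rP; apply: ereal_sup_ubound; exists (x, y) => //=.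
by split => //; apply/eqP.
Qed.

Lemma seminorm0_bound (R : realType) d (u : R -> 'cV[R]_d -> R) :
  (seminorm0 u < +oo)%E -> exists2 C : R, 0 < C &
  forall (t : R) (x : 'cV[R]_d), 0 <= t -> nonneg x -> `|u t x - u 0 x| <= C * t.
Proof.
move=> uM; have [r rP] : exists r : R, (seminorm0 u <= r%:E)%E.
  by case: (seminorm0 u) uM => [r _|//|_]; [exists r|exists 0; exact: leNye].
exists (`|r| + 1) => [|t x t0 x0]; first by rewrite ltr_wpDl.
have [->|tn] := eqVneq t 0; first by rewrite subrr normr0 mulr0.
have tp : 0 < t by rewrite lt_neqAle eq_sym tn.
rewrite -ler_pdivrMr // (@le_trans _ _ r) //; last first.
  by have := ler_norm r; lra.
rewrite -lee_fin; apply: le_trans rP; apply: ereal_sup_ubound.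
by exists (t, x).
Qed.

Lemma derive_dotp_grad (R : realType) d (h : 'cV[R]_d -> R) (x z : 'cV[R]_d) :
  differentiable h x -> 'D_z h x = dotp (grad h x) z.
Proof.
move=> dh; rewrite deriveE // {1}(_ : z = \sum_k z k 0 *: delta_mx k 0).
  rewrite linear_sum /dotp; apply: eq_bigr => k _.
  by rewrite linearZ /= mxE deriveE // mulrC.
rewrite [LHS]matrix_sum_delta; apply: eq_bigr => k _.
by rewrite big_ord1.
Qed.

Section shifted.
Context {R : realType} (K : nat).
Local Notation d := (card_D K).

Definition unshift_fun (u : R -> 'cV[R]_d -> R) (a b : R) (t : R) (x : 'cV[R]_d) : R :=
  u t x - a * b / d%:R * (\sum_k x k 0) - a ^+ 2 * b / 2 * t.

(** The nonlinearity of the equation solved by [unshift_fun]. *)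
Definition shifted_H (H : 'cV[R]_d -> R) (a b : R) (p : 'cV[R]_d) : R :=
  H (p + const_mx (a * b / d%:R)) - a ^+ 2 * b / 2.

Variables (g : R -> R) (psi : Mplus R -> R) (a b m M r : R)
  (u : R -> 'cV[R]_d -> R).
Let q := shift_kernel g b.
Hypothesis a_gt0 : 0 < a.
Hypothesis m_gt0 : 0 < m.
Hypothesis q_ge : forall z : R, z \in `[-1, 1] -> m <= q z.
Hypothesis q_le : forall z : R, z \in `[-1, 1] -> q z <= M.
Hypothesis r_ge0 : 0 <= r.
Hypothesis r_ge : a * M + M / m <= r.
Hypothesis u_sol : finite_solution q m r (shift_init psi a b) u.

Lemma unshift_sub (z0 : R * 'cV[R]_d) (c : R) (p : 'cV[R]_d) : interior_domain z0 ->
  upper_jet (fun z => unshift_fun u a b z.1 z.2) z0 c p ->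
  c <= shifted_H (H_fun q m r) a b p.
Proof.
move=> Iz J; have [_ uv _] := u_sol.
have := upper_jetD (upper_jetD J (upper_jet_time 0 (a ^+ 2 * b / 2) 0 z0))
  (upper_jet_linear (a * b / d%:R) z0).
move=> /(upper_jet_ext (g := fun z => u z.1 z.2) (b' := c + a ^+ 2 * b / 2)
  (p' := p + const_mx (a * b / d%:R))) J'.
rewrite /shifted_H lerBrDr; apply: (viscosity_upper_jet uv Iz); apply: J'.
- by move=> z; rewrite /unshift_fun /=; ring.
- by ring.
- by rewrite addr0.
Qed.

Lemma unshift_super (z0 : R * 'cV[R]_d) (c : R) (p : 'cV[R]_d) : interior_domain z0 ->
  upper_jet (fun z => - unshift_fun u a b z.1 z.2) z0 (- c) (- p) ->
  shifted_H (H_fun q m r) a b p <= c.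
Proof.
move=> Iz J; have [_ uv _] := u_sol.
have := upper_jetD (upper_jetD J (upper_jet_time 0 (- (a ^+ 2 * b / 2)) 0 z0))
  (upper_jet_linear (- (a * b / d%:R)) z0).
move=> /(upper_jet_ext (g := fun z => - u z.1 z.2) (b' := - (c + a ^+ 2 * b / 2))
  (p' := - (p + const_mx (a * b / d%:R)))) J'.
rewrite /shifted_H lerBlDr; apply: (viscosity_lower_jet uv Iz); apply: J'.
- by move=> z; rewrite /unshift_fun /=; ring.
- by ring.
- by apply/matrixP => i j; rewrite !mxE; ring.
Qed.

Lemma unshift_continuous : {within closed_domain,
  continuous (fun z : R * 'cV[R]_d => unshift_fun u a b z.1 z.2)}.
Proof.
have [_ [uc _] _] := u_sol.
apply/subspace_continuousP => z cz; move/subspace_continuousP: uc => /(_ z cz) uc.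
have cst_mul (c : R) (f : R * 'cV[R]_d -> R) : {for z, continuous f} ->
    {for z, continuous (fun z => c * f z)}.
  by move=> cf; apply: continuousM => //; exact: cst_continuous.
have c1 : {for z, continuous (fun z : R * 'cV[R]_d => a * b / d%:R * (\sum_k z.2 k 0))}.
  apply/cst_mul/continuous_fin_sum => k.
  apply: (@continuous_comp _ _ _ snd (fun M : 'cV[R]_d => M k 0)).
    exact: cvg_snd.
  exact: coord_continuous.
have c2 : {for z, continuous (fun z : R * 'cV[R]_d => a ^+ 2 * b / 2 * z.1)}.
  by apply/cst_mul; exact: cvg_fst.
have w1 : (fun z : R * 'cV[R]_d => a * b / d%:R * (\sum_k z.2 k 0)) @
    within closed_domain (nbhs z) --> a * b / d%:R * (\sum_k z.2 k 0).
  by apply: cvg_within_filter; exact: c1.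
have w2 : (fun z : R * 'cV[R]_d => a ^+ 2 * b / 2 * z.1) @
    within closed_domain (nbhs z) --> a ^+ 2 * b / 2 * z.1.
  by apply: cvg_within_filter; exact: c2.
exact: (cvgB (cvgB uc w1) w2).
Qed.

Lemma unshift_growth : exists2 C : R, 0 < C &
  forall (t : R) (x : 'cV[R]_d), 0 <= t -> nonneg x ->
    `|unshift_fun u a b t x - unshift_fun u a b 0 x| <= C * t.
Proof.
have [[[_ us] _] _ _] := u_sol; have [C C0 hC] := seminorm0_bound us.
exists (C + `|a ^+ 2 * b / 2|) => [|t x t0 x0]; first by rewrite ltr_pwDl.
rewrite (_ : _ - _ = (u t x - u 0 x) - a ^+ 2 * b / 2 * t); last first.
  by rewrite /unshift_fun; ring.
rewrite (le_trans (ler_normB _ _)) // mulrDl lerD ?hC // normrM (ger0_norm t0) //.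
Qed.

Lemma unshift_init (x : 'cV[R]_d) : nonneg x -> unshift_fun u a b 0 x = discretize psi x.
Proof.
move=> x0; have [_ _ ui] := u_sol.
by rewrite /unshift_fun ui // /discretize /shift_init mass_mu_of //; ring.
Qed.

Lemma shifted_H_mono (p p' : 'cV[R]_d) : (forall k, p k 0 <= p' k 0) ->
  shifted_H (H_fun q m r) a b p <= shifted_H (H_fun q m r) a b p'.
Proof.
move=> pp; rewrite /shifted_H lerD2r; apply: (H_fun_mono m_gt0 r_ge0 q_ge) => k.
by rewrite !mxE lerD2r.
Qed.

Definition H_error : R := M * a / m + 2 * r * M / m ^+ 2 + M / m ^+ 2.

(** The shift of the kernel adds [a b / d] to every entry of [G x], because the
    entries of [x] sum to [a d], and it adds [a^2 b / 2] to the energy. *)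
Lemma shifted_H_near_cone (x w : 'cV[R]_d) (rho : R) :
  nonneg x -> \sum_k x k 0 = a * d%:R -> 0 <= rho -> rho <= 1 ->
  (forall k, `|w k 0| <= rho / d%:R) ->
  `|shifted_H (H_fun q m r) a b (kmx K g *m x + w) - 2^-1 * dotp (kmx K g *m x) x|
    <= H_error * rho.
Proof.
move=> x0 xs rho0 rho1 wr.
have dn0 : (d%:R : R) != 0 by rewrite pnatr_eq0 -lt0n expn_gt0.
have xa : norm1 x = a by rewrite norm1_nonneg // xs; field.
have qx : kmx K q *m x = kmx K g *m x + const_mx (a * b / d%:R).
  rewrite /q kmx_shift_mul xs; congr (_ + const_mx _); field; exact: dn0.
have := H_fun_near_cone m_gt0 r_ge0 q_ge q_le (ltW a_gt0) r_ge x0 xa rho0 rho1 wr.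
have -> : energy q x = 2^-1 * dotp (kmx K g *m x) x + a ^+ 2 * b / 2.
  rewrite /energy qx dotpDl mulrDr; congr (_ + _).
  rewrite /dotp; under [X in _ * X = _]eq_bigr do rewrite mxE.
  by rewrite -mulr_sumr xs; field.
rewrite /shifted_H qx (_ : kmx K g *m x + const_mx _ + w =
    kmx K g *m x + w + const_mx (a * b / d%:R)).
  by rewrite (_ : _ - (_ + _) = H_fun q m r (kmx K g *m x + w + const_mx (a * b / d%:R))
    - a ^+ 2 * b / 2 - 2^-1 * dotp (kmx K g *m x) x) //; ring.
by rewrite addrAC.
Qed.

End shifted.

(** * Comparison of two shifts at a fixed resolution *)

(** Off the exceptional null set, the derivative in the direction [x - x'] is the
    product with an element [G z + w] of the constraint set, which [gauge]
    dominates. *)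
Lemma init_le_gauge (R : realType) (K : nat) (g : R -> R) (psi : Mplus R -> R)
    (a L be ep : R) (x x' : 'cV[R]_(card_D K)) :
  (1 <= K)%N -> 0 <= L -> (forall mu nu, `|psi mu - psi nu| <= L * TV mu nu) ->
  H3' g psi a -> 0 < be -> 0 < ep -> nonneg x -> nonneg x' ->
  discretize psi x - discretize psi x' <=
  gauge (kmx K g) a (Num.sqrt (card_D K)%:R)^-1 be ep (x - x').
Proof.
move=> K1 L0 psiL [a0 psi3] be0 ep0 x0 x'0.
have d0 := card_D_gt0 K.
have dp : (0 : R) < (card_D K)%:R by rewrite ltr0n.
apply: (@increment_le_of_gradient _ _ _ (L * (card_D K)%:R^-1) _ x' x _ x'0 x0 _ _ (psi3 K K1)).
- by rewrite mulr_ge0 // invr_ge0.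
- move=> y y' y0 y'0; apply: (le_trans (psiL _ _)); rewrite -mulrA ler_wpM2l //.
  exact: TV_mu_of.
- move=> y y0 /not_andP[//|/contrapT[dy [[p w] [[z [z0 za] <-] wr] E]]].
  split => //; rewrite derive_dotp_grad // -E /=.
  apply: gauge_ge => //.
  + by rewrite -za norm1_nonneg //; field; rewrite gt_eqF.
  + move=> k; rewrite ler_pdivlMr // mulrC; apply: le_trans wr.
    exact: le_bigmax.
Qed.

Lemma H_error_ge0 (R : realType) (a m M r : R) : 0 < a -> 0 < m -> 0 <= M -> 0 <= r ->
  0 <= H_error a m M r.
Proof.
by move=> /ltW a0 /ltW m0 M0 r0; rewrite /H_error !addr_ge0 // divr_ge0 ?mulr_ge0 ?exprn_ge0.
Qed.

Section finite.
Context {R : realType} (K : nat).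
Local Notation d := (card_D K).
Variables (g : R -> R) (psi : Mplus R -> R) (a L : R).
Variables (b m M r : R) (u : R -> 'cV[R]_d -> R).
Variables (b' m' M' r' : R) (u' : R -> 'cV[R]_d -> R).
Hypothesis K1 : (1 <= K)%N.
Hypothesis L0 : 0 <= L.
Hypothesis psiL : forall mu nu, `|psi mu - psi nu| <= L * TV mu nu.
Hypothesis psi3 : H3' g psi a.
Hypothesis m_gt0 : 0 < m.
Hypothesis q_ge : forall z : R, z \in `[-1, 1] -> m <= shift_kernel g b z.
Hypothesis q_le : forall z : R, z \in `[-1, 1] -> shift_kernel g b z <= M.
Hypothesis r_ge0 : 0 <= r.
Hypothesis r_ge : a * M + M / m <= r.
Hypothesis u_sol : finite_solution (shift_kernel g b) m r (shift_init psi a b) u.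
Hypothesis m'_gt0 : 0 < m'.
Hypothesis q'_ge : forall z : R, z \in `[-1, 1] -> m' <= shift_kernel g b' z.
Hypothesis q'_le : forall z : R, z \in `[-1, 1] -> shift_kernel g b' z <= M'.
Hypothesis r'_ge0 : 0 <= r'.
Hypothesis r'_ge : a * M' + M' / m' <= r'.
Hypothesis u'_sol : finite_solution (shift_kernel g b') m' r' (shift_init psi a b') u'.

Let v := unshift_fun u a b.
Let v' := unshift_fun u' a b'.
Let rho : R := (Num.sqrt d%:R)^-1.
Let ka := 2 * (H_error a m M r + H_error a m' M' r') * rho.

Let a_gt0 : 0 < a. Proof. by case: psi3. Qed.
Let d_gt0 : (0 : R) < d%:R. Proof. by rewrite ltr0n card_D_gt0. Qed.
Let rho_gt0 : 0 < rho. Proof. by rewrite invr_gt0 sqrtr_gt0. Qed.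

Let rho_le : 2 * rho <= 1.
Proof.
rewrite /rho ler_pdivrMr ?sqrtr_gt0 // mul1r -[X in X <= _]ger0_norm // -sqrtr_sqr.
apply: ler_wsqrtr; rewrite -natrX ler_nat /card_D.
by rewrite leq_exp2l.
Qed.

Let bound_ge0 (mm MM bb : R) : 0 < mm ->
  (forall z : R, z \in `[-1, 1] -> mm <= shift_kernel g bb z) ->
  (forall z : R, z \in `[-1, 1] -> shift_kernel g bb z <= MM) -> 0 <= MM.
Proof.
move=> m0 h1 h2; have z0 : (0 : R) \in `[-1, 1] by rewrite in_itv /= lerN10 ler01.
exact: (le_trans (ltW m0) (le_trans (h1 _ z0) (h2 _ z0))).
Qed.

Let ka_ge0 : 0 <= ka.
Proof.
rewrite /ka mulr_ge0 ?(ltW rho_gt0) // mulr_ge0 // addr_ge0 // H_error_ge0 //.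
  exact: bound_ge0 q_ge q_le.
exact: bound_ge0 q'_ge q'_le.
Qed.

(** The gradients of [gauge] lie in the constraint set; moving them by [al] at most
    doubles the distance [rho] to the cone, and on that neighborhood both
    nonlinearities are close to the same energy. *)
Lemma finite_comparison_gauge (be ep t : R) (x : 'cV[R]_d) : 0 < be -> 0 < ep ->
  0 <= t -> positive x -> v t x - v' t x <= ka * t + gauge (kmx K g) a rho be ep 0.
Proof.
move=> be0 ep0 t0 xp.
have [C1 C10 hC1] := unshift_growth u_sol.
have [C2 C20 hC2] := unshift_growth u'_sol.
apply: (@jet_comparison R d v v' (shifted_H (H_fun (shift_kernel g b) m r) a b)
  (shifted_H (H_fun (shift_kernel g b') m' r') a b') (gauge (kmx K g) a rho be ep)
  (dgauge (kmx K g) a rho be ep) (C1 + C2) ka (rho / d%:R)) => //.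
- exact: addr_gt0.
- by rewrite divr_gt0.
- exact: unshift_continuous u_sol.
- exact: unshift_continuous u'_sol.
- move=> s y s0 y0; have := hC1 s y s0 y0; have := mulr_ge0 (ltW C20) s0.
  by rewrite ler_norml -/v => ? /andP[_ ?]; lra.
- move=> s y s0 y0; have := hC2 s y s0 y0; have := mulr_ge0 (ltW C10) s0.
  by rewrite ler_norml -/v' => ? /andP[? _]; lra.
- by move=> z0 c p Iz J; exact: (unshift_sub u_sol Iz J).
- by move=> z0 c p Iz J; exact: (unshift_super u'_sol Iz J).
- by move=> p q; exact: shifted_H_mono.
- by move=> p q; exact: shifted_H_mono.
- by move=> z; apply: gauge_continuous => //; exact: card_D_gt0.
- move=> z0; apply: gauge_quadratic => //; [exact: card_D_gt0|exact: ltW].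
- move=> y y' y0 y'0; rewrite /v /v' (unshift_init u_sol) // (unshift_init u'_sol) //.
  exact: (init_le_gauge K1 L0).
- move=> z al al0 al1.
  have [y [w [-> y0 ys wr]]] := dgauge_in (kmx K g) be (card_D_gt0 K) a_gt0 (ltW rho_gt0) ep0 z.
  have rho2 : 0 <= 2 * rho by rewrite mulr_ge0 // ltW.
  have near (c : R) : `|c| <= al ->
      forall k, `|(w + const_mx c) k 0| <= 2 * rho / d%:R.
    move=> cal k; rewrite !mxE; apply: (le_trans (ler_normD _ _)).
    rewrite (_ : 2 * rho / d%:R = rho / d%:R + rho / d%:R); last by ring.
    by apply: lerD; [exact: wr|rewrite (le_trans cal)].
  have e1 := shifted_H_near_cone a_gt0 m_gt0 q_ge q_le r_ge0 r_ge y0 ys rho2 rho_le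
    (near al (eq_ind_r (fun z => z <= al) (lexx al) (gtr0_norm al0))).
  have nal : `|- al| <= al by rewrite normrN gtr0_norm.
  have e2 := shifted_H_near_cone a_gt0 m'_gt0 q'_ge q'_le r'_ge0 r'_ge y0 ys rho2 rho_le
    (near (- al) nal).
  have -> : kmx K g *m y + w + const_mx al = kmx K g *m y + (w + const_mx al).
    by rewrite addrA.
  have -> : kmx K g *m y + w - const_mx al = kmx K g *m y + (w + const_mx (- al)).
    by rewrite -addrA; congr (_ + (_ + _)); apply/matrixP => i j; rewrite !mxE.
  move: e1 e2; rewrite !ler_norml => /andP[_ e1] /andP[e2 _].
  have -> : ka = H_error a m M r * (2 * rho) + H_error a m' M' r' * (2 * rho).
    by rewrite /ka; ring.
  move: e1 e2; move: (shifted_H _ _ _ _) (shifted_H _ _ _ _) (dotp _ _).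
  move: (H_error _ _ _ _ * _) (H_error _ _ _ _ * _) => h1 h2 s1 s2 E e1 e2; lra.
Qed.

(** The gauge at the origin, [a d ln d / be + rho ep], vanishes as the smoothing is
    removed. *)
Lemma finite_comparison_pos (t : R) (x : 'cV[R]_d) : 0 <= t -> positive x ->
  v t x - v' t x <= ka * t.
Proof.
move=> t0 xp; apply/ler_addgt0Pl => th th0.
have l0 : 0 <= ln (d%:R : R) by rewrite ln_ge0 // ler1n card_D_gt0.
pose c := a * d%:R * ln d%:R.
have c0 : 0 <= c by rewrite mulr_ge0 // mulr_ge0 // ltW.
have be0 : 0 < (c + 1) * 2 / th by rewrite divr_gt0 // mulr_gt0 // ltr_wpDl.
have ep0 : 0 < th / 2 by rewrite divr_gt0.
have := finite_comparison_gauge be0 ep0 t0 xp.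
rewrite gauge0 //; last exact: card_D_gt0.
have -> : a * d%:R / ((c + 1) * 2 / th) * ln d%:R = th / 2 * (c / (c + 1)).
  by rewrite /c; field; rewrite (gt_eqF th0) andbT gt_eqF // ltr_wpDl.
have h1 : th / 2 * (c / (c + 1)) <= th / 2.
  by rewrite ler_piMr ?(ltW ep0) // ler_pdivrMr ?ltr_wpDl // mul1r lerDl.
have h2 : rho * (th / 2) <= th / 2.
  by rewrite ler_piMl ?(ltW ep0) //; have := rho_le; have := rho_gt0; lra.
move/le_trans; apply; move: h1 h2; lra.
Qed.

(** Points of the boundary are reached by moving into the orthant along the
    diagonal, both solutions being Lipschitz in space. *)
Lemma finite_comparison (t : R) (x : 'cV[R]_d) : 0 <= t -> nonneg x ->
  v t x - v' t x <= ka * t.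
Proof.
move=> t0 x0; apply/ler_addgt0Pl => th th0.
have lipu (w : R -> 'cV[R]_d -> R) : L_unif w -> exists2 M0 : R, 0 <= M0 &
    forall y z : 'cV[R]_d, nonneg y -> nonneg z -> `|w t y - w t z| <= M0 * norm1 (y - z).
  move=> [_ wl]; apply: lip1_bound; first exact: card_D_gt0.
  by apply: le_lt_trans wl; apply: ereal_sup_ubound; exists t.
have [M1 M10 h1] : exists2 M0 : R, 0 <= M0 &
    forall y z : 'cV[R]_d, nonneg y -> nonneg z -> `|u t y - u t z| <= M0 * norm1 (y - z).
  by apply: lipu; case: u_sol.
have [M2 M20 h2] : exists2 M0 : R, 0 <= M0 &
    forall y z : 'cV[R]_d, nonneg y -> nonneg z -> `|u' t y - u' t z| <= M0 * norm1 (y - z).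
  by apply: lipu; case: u'_sol.
pose N := M1 + M2 + `|a * (b - b')| + 1.
have N0 : 0 < N by rewrite ltr_wpDl // !addr_ge0.
pose e := th / N; have e0 : 0 < e by rewrite divr_gt0.
have eN : N * e = th by rewrite /e; field; rewrite gt_eqF.
pose y := x + e *: const_mx 1.
have yp : positive y by move=> k; rewrite !mxE mulr1 ltr_wpDl.
have y0 : nonneg y by move=> k; exact/ltW.
have xy : norm1 (x - y) = e.
  rewrite /norm1 (eq_bigr (fun=> e)).
    by rewrite sumr_const card_ord -mulr_natr; field; rewrite gt_eqF.
  by move=> k _; rewrite !mxE mulr1 opprD addrA subrr sub0r normrN gtr0_norm.
have sy : \sum_k y k 0 = \sum_k x k 0 + e * d%:R.
  under eq_bigr do rewrite !mxE mulr1.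
  by rewrite big_split /= sumr_const card_ord mulr_natr.
have := finite_comparison_pos t0 yp.
have := h1 x y x0 y0; have := h2 x y x0 y0; rewrite xy !ler_norml.
move=> /andP[e1 _] /andP[_ e2].
have e3 : a * (b - b') * e <= `|a * (b - b')| * e.
  by rewrite ler_wpM2r ?(ltW e0) // ler_norm.
rewrite /v /v' /unshift_fun sy.
rewrite (_ : _ - _ - _ - _ = u t y - u' t y - 
    (a * b / d%:R * (\sum_k x k 0) + a ^+ 2 * b / 2 * t)
  + (a * b' / d%:R * (\sum_k x k 0) + a ^+ 2 * b' / 2 * t) - a * (b - b') * e); last first.
  by field; rewrite gt_eqF.
rewrite -eN (_ : N * e = M1 * e + M2 * e + `|a * (b - b')| * e + e); last by rewrite /N; ring.
move: e1 e2 e3; move: (M1 * e) (M2 * e) (`|_| * e) (a * (b - b') * e) => s1 s2 s3 s4.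
move: (a * b / _ * _) (a * b' / _ * _) (_ * b / 2 * t) (_ * b' / 2 * t) (ka * t) => X X' P P' k.
move: (u t x) (u t y) (u' t x) (u' t y) e0 => ux uy ux' uy' e00 e1 e2 e3 e4; lra.
Qed.

End finite.

(** * Passage to the limit *)

Lemma inv_sqrt_card_small (R : realType) (e : R) : 0 < e ->
  \forall K \near \oo, (Num.sqrt (card_D K)%:R)^-1 <= e.
Proof.
move=> e0; near=> K.
have K0 : e ^- 2 <= (card_D K)%:R.
  apply: (@le_trans _ _ K%:R); last by rewrite ler_nat /card_D ltnW // ltnW // ltn_expl.
  by near: K; exact: nbhs_infty_ger.
rewrite -[leRHS]invrK lef_pV2 ?posrE ?invr_gt0 ?sqrtr_gt0 ?ltr0n ?expn_gt0 //.
rewrite -[leLHS]ger0_norm ?invr_ge0 ?(ltW e0) // -sqrtr_sqr.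
by apply: ler_wsqrtr; rewrite exprVn.
Unshelve. all: by end_near. Qed.

(** Any large enough truncation radius gives the same limit, so it may be chosen for
    the two kernels separately, before [K]. *)
Lemma unshift_le (R : realType) (g : R -> R) (psi : Mplus R -> R) (a b b' : R)
    (f f' : R -> Mplus R -> R) (t : R) (mu : Mplus R) :
  C1_itv g -> H2 psi -> H3' g psi a ->
  hj_solution (shift_kernel g b) (shift_init psi a b) f ->
  hj_solution (shift_kernel g b') (shift_init psi a b') f' ->
  0 <= t -> unshift f a b t mu <= unshift f' a b' t mu.
Proof.
move=> gC1 psi2 psi3 [m [m0 mq hr]] [m' [m'0 mq' hr']] t0.
have [a0 _] := psi3.
have [M0 M00 gM] := C1_bounded gC1.
have qM (c z : R) : z \in `[-1, 1] -> shift_kernel g c z <= M0 + `|c|.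
  by move=> /gM; rewrite /shift_kernel ler_norml => /andP[_ gz]; rewrite lerD // ler_norm.
have radius (c n : R) : 0 < n -> exists r : R,
    [/\ 0 <= r, a * (M0 + `|c|) + (M0 + `|c|) / n <= r &
        (lipTV (shift_init psi a c) < r%:E)%E].
  move=> n0; have [L [L0 [_ Llip]]] := lipTV_shift_init a c psi2.
  have h1 : 0 <= a * (M0 + `|c|) by rewrite mulr_ge0 ?addr_ge0 // ltW.
  have h2 : 0 <= (M0 + `|c|) / n by rewrite divr_ge0 ?addr_ge0 // ltW.
  have h3 := normr_ge0 (a * c).
  exists (L + `|a * c| + 1 + (a * (M0 + `|c|) + (M0 + `|c|) / n)); split; [lra|lra|].
  by apply: (le_lt_trans Llip); rewrite lte_fin; lra.
have [r [r0 rM rlip]] := radius b m m0; have [r' [r'0 rM' rlip']] := radius b' m' m'0.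
have [L [L0 [psiL _]]] := lipTV_shift_init a b psi2.
have [u usol ulim] := hr r rlip; have [u' usol' ulim'] := hr' r' rlip'.
pose c := 2 * (H_error a m (M0 + `|b|) r + H_error a m' (M0 + `|b'|) r') * t.
have c0 : 0 <= c.
  by rewrite !mulr_ge0 // addr_ge0 // H_error_ge0 // addr_ge0.
apply/ler_addgt0Pl => e e0.
have e1 : 0 < e / (c + 1) by rewrite divr_gt0 // ltr_wpDl.
have lim : (fun K => u K t (x_of K mu) - u' K t (x_of K mu)) @ \oo -->
    f t mu - f' t mu by apply: cvgB; [exact: ulim|exact: ulim'].
pose B := e + (a * b * mass mu + a ^+ 2 * b * t / 2) - (a * b' * mass mu + a ^+ 2 * b' * t / 2).
suff : f t mu - f' t mu <= B by rewrite /B /unshift; lra.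
apply: (cvgr_to_le lim); near=> K.
have K1 : (1 <= K)%N by near: K; exact: nbhs_infty_ge.
have rhoK : (Num.sqrt (card_D K)%:R)^-1 <= e / (c + 1).
  by near: K; exact: inv_sqrt_card_small.
have [us _] := usol K K1; have [us' _] := usol' K K1.
have := finite_comparison K1 L0 psiL psi3 m0 mq (@qM b) r0 rM us
  m'0 mq' (@qM b') r'0 rM' us' t0 (@x_of_nonneg R K mu).
rewrite /unshift_fun.
have massE (s : R) : a * s / (card_D K)%:R * (\sum_k x_of K mu k 0) = a * s * mass mu.
  by rewrite -(sum_x_of K mu) mulrA.
rewrite !massE => h.
have h2 : 2 * (H_error a m (M0 + `|b|) r + H_error a m' (M0 + `|b'|) r') *
    (Num.sqrt (card_D K)%:R)^-1 * t <= e.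
  rewrite mulrAC -/c; apply: (le_trans (ler_wpM2l c0 rhoK)).
  rewrite (_ : c * (e / (c + 1)) = e * (c / (c + 1))); last by ring.
  by rewrite ler_piMr ?(ltW e0) // ler_pdivrMr ?ltr_wpDl // mul1r lerDl.
have := le_trans h h2; rewrite /B /=.
rewrite (_ : a ^+ 2 * b / 2 * t = a ^+ 2 * b * t / 2); last by ring.
rewrite (_ : a ^+ 2 * b' / 2 * t = a ^+ 2 * b' * t / 2); last by ring.
by lra.
Unshelve. all: by end_near. Qed.

Theorem theorem1p4 (R : realType) (g : R -> R) (psi : Mplus R -> R) (a : R)
    (g_C1 : C1_itv g) (psi_H2 : H2 psi) (psi_H3' : H3' g psi a) (psi_H4 : H4 psi)
    (b b' : R)
    (gb_pos : positive_kernel (shift_kernel g b))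
    (gb'_pos : positive_kernel (shift_kernel g b'))
    (ftilde_b ftilde_b' : R -> Mplus R -> R)
    (ftilde_b_sol : hj_solution (shift_kernel g b) (shift_init psi a b) ftilde_b)
    (ftilde_b'_sol :
      hj_solution (shift_kernel g b') (shift_init psi a b') ftilde_b')
    (t : R) (mu : Mplus R) (t_ge0 : 0 <= t) :
  unshift ftilde_b a b t mu = unshift ftilde_b' a b' t mu.
Proof.
apply/eqP; rewrite eq_le; apply/andP; split.
  exact: unshift_le g_C1 psi_H2 psi_H3' ftilde_b_sol ftilde_b'_sol t_ge0.
exact: unshift_le g_C1 psi_H2 psi_H3' ftilde_b'_sol ftilde_b_sol t_ge0.
Qed.
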